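(* Suppose the parameters $(A_0,\ldots,A_{k-1},q_0,\ldots,q_{k-1},q,\lambda)$ of $R$ are admissible. Then the maps $\bar X,\bar W,\bar Y,\bar E:\Xi\to\Xi$ satisfy the following identities: $$\bar X\bar W=\bar W\bar X=1,$$ $$\bar X\bar E=\bar E\bar X=\lambda\bar E,$$ $$\bar X\bar Y\bar X\bar Y=\bar Y\bar X\bar Y\bar X,$$ $$\bar E\bar Y\bar X\bar Y=\bar Y\bar X\bar Y\bar E=\lambda^{-1}\bar E,$$ $$\bar E\bar Y^m\bar E=A_m\bar E\quad\text{for all } 0\le m\le k-1,$$ $$\sum_{l=0}^kq_l\bar Y^l=0.$$ Furthermore $\Xi$ is a $\mathscr{B}_2^k(R)$-module where the actions of the generators $Y$, $X$, $X^{-1}$ and $e$ on $\Xi$ are given by the maps $\bar Y$, $\bar X$, $\bar W$ and $\bar E$, respectively.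
   Context: Parameters. Let $k\ge 1$ be a natural number. Let $R$ be a commutative ring containing units $q_0,q,\lambda$ and further elements $A_0,\ldots,A_{k-1},q_1,\ldots,q_{k-1}$ such that $\lambda-\lambda^{-1}=\delta(1-A_0)$, where $\delta:=q-q^{-1}$. Assume $\delta$ is not a zero divisor in $R$. Put $q_k:=-1$. The algebra. $\mathscr{B}_2^k(R)$ is the unital associative $R$-algebra generated by $Y^{\pm1},X^{\pm1},e$ subject to: $Y^k=\sum_{i=0}^{k-1}q_iY^i$; $X-X^{-1}=\delta(1-e)$; $XYXY=YXYX$; $Xe=\lambda e=eX$; $YXYe=\lambda^{-1}e=eYXY$; $eY^me=A_me$ for $0\le m\le k-1$. Admissibility. Write $k=2z-\epsilon$ with $z=\lceil k/2\rceil$, so $\epsilon=0$ if $k$ is even and $\epsilon=1$ if $k$ is odd. Set $$\beta=q_0\lambda-q_0^{-1}\lambda^{-1}+(1-\epsilon)\delta,$$ and for $1\le l\le k-1$, $$h_l=\lambda^{-1}(q_l+q_0^{-1}q_{k-l})+\delta\left[\sum_{r=1}^{k-l}q_{r+l}A_r-\sum_{i=\max(l+1,z)}^{\lfloor (l+k)/2\rfloor}q_{2i-l}+\sum_{i=\lceil l/2\rceil}^{\min(l,z-1)}q_{2i-l}\right]$$ (empty sums are $0$). The parameters are called admissible if $\lambda-\lambda^{-1}=\delta(1-A_0)$ and $h_1=\cdots=h_{k-1}=\beta=0$. The module $V$. $V$ is the free $R$-module with basis $v_0,\ldots,v_{k-1}$. The linear map $Y_V:V\to V$ is given by $Y_Vv_i=v_{i+1}$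 for $0\le i\le k-2$ and $Y_Vv_{k-1}=\sum_{i=0}^{k-1}q_iv_i$; it is invertible since $q_0$ is a unit. Put $v_s=Y_V^sv_0$ for every integer $s$. The linear maps $X_V,E_V:V\to V$ are given on the basis by $X_Vv_0=\lambda v_0$, $X_Vv_1=\lambda^{-1}Y_V^{-1}v_0$ (if $k\ge 2$), $X_Vv_i=Y_V^{-1}X_Vv_{i-1}-\delta v_{i-2}+\delta A_{i-1}Y_V^{-1}v_0$ for $2\le i\le k-1$, and $E_Vv_i=A_iv_0$ for $0\le i\le k-1$. The module $\Xi$. Let $\Xi_0=V\otimes_RV$, let $\xi_1:\Xi_0\to\Xi_1$ and $\xi_2:\Xi_0\to\Xi_2$ be isomorphisms onto two further copies of $\Xi_0$, and $\Xi=\Xi_0\oplus\Xi_1\oplus\Xi_2$. For all integers $i,j$ put $v_{i,j}=v_i\otimes v_j$, $u_{i,j}=\xi_1(v_{i,j})$, $w_{i,j}=\xi_2(v_{i,j})$; the elements $v_{i,j},u_{i,j},w_{i,j}$ with $0\le i,j\le k-1$ form an $R$-basis of $\Xi$. Define $R$-linear maps $\bar Y,\bar X,\bar E:\Xi\to\Xi$ as follows. On $\Xi_0$ they are $Y_V\otimes 1$, $X_V\otimes 1$, $E_V\otimes 1$ respectively. For $0\le i,j\le k-1$: $$\bar Eu_{i,j}=v_0\otimes Y_V^jX_VY_V^iv_0,\qquad \bar Ew_{i,j}=v_0\otimes Y_V^jX_VY_V^iX_Vv_0=\lambda\bar Eu_{i,j},$$ $$\bar Xu_{i,j}=w_{i,j},\qquad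 \bar Xw_{i,j}=u_{i,j}+\delta w_{i,j}-\delta\lambda\bar Eu_{i,j},$$ $$\bar Yu_{i,j}=u_{i+1,j},\qquad \bar Yw_{i,j}=\bar Wu_{i,j+1}+\delta u_{1,i+j}-\delta\,\bar Y\bar Xv_{i,j},$$ where $\bar W:=\bar X-\delta+\delta\bar E$. *)

(* Defs.v *)
From HB Require Import structures.
From mathcomp Require Import all_boot all_order all_algebra.
From mathcomp Require Import boolp.
From mathcomp Require Import monalg.

Set Implicit Arguments.
Unset Strict Implicit.
Unset Printing Implicit Defensive.

Import GRing.Theory.
Local Open Scope ring_scope.
Local Open Scope quotient_scope.

(* The quotient of a possibly noncommutative ring A by the two-sided ideal
   generated by S; the ideal quotients of ring_quotient.v only carry a ring
   structure when the base ring is commutative. *)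
Section TwoSidedQuotient.
Variables (A : pzRingType) (S : A -> Prop).

Inductive two_sided_ideal : A -> Prop :=
| TsiGen x : S x -> two_sided_ideal x
| Tsi0 : two_sided_ideal 0
| TsiD x y : two_sided_ideal x -> two_sided_ideal y -> two_sided_ideal (x + y)
| TsiM a x b : two_sided_ideal x -> two_sided_ideal (a * x * b).

Definition tsq_rel : rel A := fun x y => `[< two_sided_ideal (x - y) >].

Lemma tsiN x : two_sided_ideal x -> two_sided_ideal (- x).
Proof. by move=> /(TsiM (-1) 1); rewrite mulN1r mulr1. Qed.

Lemma tsq_refl : reflexive tsq_rel.
Proof. by move=> x; apply/asboolP; rewrite subrr; exact: Tsi0. Qed.

Lemma tsq_sym : symmetric tsq_rel.
Proof. by move=> x y; apply/asboolP/asboolP => /tsiN; rewrite opprB. Qed.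

Lemma tsq_trans : transitive tsq_rel.
Proof.
move=> y x z /asboolP xy /asboolP yz; apply/asboolP.
by have := TsiD xy yz; rewrite addrA subrK.
Qed.

Canonical tsq_equiv := EquivRel tsq_rel tsq_refl tsq_sym tsq_trans.

Definition tsq : Type := {eq_quot tsq_rel}.
HB.instance Definition _ := Choice.on tsq.
HB.instance Definition _ := EqQuotient.on tsq.

Definition tsq_pi (x : A) : tsq := \pi_tsq x.

Lemma tsq_piP x y : tsq_pi x = tsq_pi y <-> two_sided_ideal (x - y).
Proof. by split=> [/eqmodP/asboolP //|xy]; apply/eqmodP/asboolP. Qed.

Definition tsq_add (x y : tsq) := tsq_pi (repr x + repr y).
Definition tsq_opp (x : tsq) := tsq_pi (- repr x).
Definition tsq_mul (x y : tsq) := tsq_pi (repr x * repr y).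

Lemma tsq_repr_pi x : two_sided_ideal (repr (tsq_pi x) - x).
Proof. by apply/tsq_piP; rewrite /tsq_pi reprK. Qed.

Lemma tsq_addE x y : tsq_add (tsq_pi x) (tsq_pi y) = tsq_pi (x + y).
Proof.
apply/tsq_piP; rewrite opprD addrACA.
by apply: TsiD; exact: tsq_repr_pi.
Qed.

Lemma tsq_oppE x : tsq_opp (tsq_pi x) = tsq_pi (- x).
Proof. by apply/tsq_piP; rewrite -opprD; apply: tsiN; exact: tsq_repr_pi. Qed.

Lemma tsq_mulE x y : tsq_mul (tsq_pi x) (tsq_pi y) = tsq_pi (x * y).
Proof.
apply/tsq_piP; set x' := repr _; set y' := repr _.
have -> : x' * y' - x * y = 1 * (x' - x) * y' + x * (y' - y) * 1.
  by rewrite mul1r mulr1 mulrBl mulrBr addrA subrK.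
by apply: TsiD; apply: TsiM; exact: tsq_repr_pi.
Qed.

Lemma tsq_ind (P : tsq -> Prop) : (forall x, P (tsq_pi x)) -> forall x, P x.
Proof. by move=> Px x; rewrite -[x]reprK; exact: Px. Qed.

Fact tsq_addA : associative tsq_add.
Proof.
by elim/tsq_ind=> x; elim/tsq_ind=> y; elim/tsq_ind=> z; rewrite !tsq_addE addrA.
Qed.

Fact tsq_addC : commutative tsq_add.
Proof. by elim/tsq_ind=> x; elim/tsq_ind=> y; rewrite !tsq_addE addrC. Qed.

Fact tsq_add0r : left_id (tsq_pi 0) tsq_add.
Proof. by elim/tsq_ind=> x; rewrite tsq_addE add0r. Qed.

Fact tsq_addNr : left_inverse (tsq_pi 0) tsq_opp tsq_add.
Proof. by elim/tsq_ind=> x; rewrite tsq_oppE tsq_addE addNr. Qed.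

Fact tsq_mulA : associative tsq_mul.
Proof.
by elim/tsq_ind=> x; elim/tsq_ind=> y; elim/tsq_ind=> z; rewrite !tsq_mulE mulrA.
Qed.

Fact tsq_mul1r : left_id (tsq_pi 1) tsq_mul.
Proof. by elim/tsq_ind=> x; rewrite tsq_mulE mul1r. Qed.

Fact tsq_mulr1 : right_id (tsq_pi 1) tsq_mul.
Proof. by elim/tsq_ind=> x; rewrite tsq_mulE mulr1. Qed.

Fact tsq_mulDl : left_distributive tsq_mul tsq_add.
Proof.
elim/tsq_ind=> x; elim/tsq_ind=> y; elim/tsq_ind=> z.
by rewrite !(tsq_addE, tsq_mulE) mulrDl.
Qed.

Fact tsq_mulDr : right_distributive tsq_mul tsq_add.
Proof.
elim/tsq_ind=> x; elim/tsq_ind=> y; elim/tsq_ind=> z.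
by rewrite !(tsq_addE, tsq_mulE) mulrDr.
Qed.

HB.instance Definition _ := GRing.isPzRing.Build tsq tsq_addA tsq_addC
  tsq_add0r tsq_addNr tsq_mulA tsq_mul1r tsq_mulr1 tsq_mulDl tsq_mulDr.

Fact tsq_pi_zmod_morphism : zmod_morphism tsq_pi.
Proof. by move=> x y; rewrite -tsq_addE -tsq_oppE. Qed.

Fact tsq_pi_monoid_morphism : monoid_morphism tsq_pi.
Proof. by split=> // x y; rewrite -tsq_mulE. Qed.

HB.instance Definition _ :=
  GRing.isZmodMorphism.Build A tsq tsq_pi tsq_pi_zmod_morphism.
HB.instance Definition _ :=
  GRing.isMonoidMorphism.Build A tsq tsq_pi tsq_pi_monoid_morphism.

End TwoSidedQuotient.

Section TwoSidedQuotientLmodule.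
Variables (R : pzRingType) (A : lalgType R) (S : A -> Prop).
Implicit Types (c d : R) (x y : tsq S).

Definition tsq_scale c x : tsq S := tsq_pi S c%:A * x.

Fact tsq_scaleA c d x : tsq_scale c (tsq_scale d x) = tsq_scale (c * d) x.
Proof. by rewrite /tsq_scale mulrA -rmorphM /= mulr_algl scalerA. Qed.

Fact tsq_scale1r : left_id 1 tsq_scale.
Proof. by move=> x; rewrite /tsq_scale scale1r rmorph1 mul1r. Qed.

Fact tsq_scaleDr : right_distributive tsq_scale +%R.
Proof. by move=> c x y; rewrite /tsq_scale mulrDr. Qed.

Fact tsq_scaleDl x : {morph tsq_scale^~ x : c d / c + d}.
Proof. by move=> c d; rewrite /tsq_scale scalerDl rmorphD mulrDl. Qed.

HB.instance Definition _ := GRing.Zmodule_isLmodule.Build R (tsq S)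
  tsq_scaleA tsq_scale1r tsq_scaleDr tsq_scaleDl.

Lemma tsq_piZ c (a : A) : tsq_pi S (c *: a) = c *: tsq_pi S a.
Proof. by rewrite [RHS]/GRing.scale /= /tsq_scale -rmorphM /= mulr_algl. Qed.

End TwoSidedQuotientLmodule.

(* The tuple qs lists q_0, ..., q_{k-1} and As lists A_0, ..., A_{k-1}. *)
Record params (R : comUnitRingType) (k : nat) := Params {
  qs : k.-tuple R;
  As : k.-tuple R;
  qq : R;
  lam : R
}.

Section Conditions.
Variables (R : comUnitRingType) (k : nat) (p : params R k).

(* q_l for 0 <= l <= k, with q_k = -1. *)
Definition qc (l : nat) : R := (rcons (qs p) (-1))`_l.
Definition Ac (m : nat) : R := (As p)`_m.
Definition delta : R := qq p - (qq p)^-1.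

Definition param_conditions : Prop :=
  [/\ qc 0 \is a GRing.unit, qq p \is a GRing.unit, lam p \is a GRing.unit,
      lam p - (lam p)^-1 = delta * (1 - Ac 0) & GRing.lreg delta].

(* uphalf n is the ceiling of n / 2, and odd k is the epsilon with
   k = 2 z - epsilon. *)
Definition zc : nat := uphalf k.

Definition beta : R :=
  qc 0 * lam p - (qc 0)^-1 * (lam p)^-1 + (1 - (odd k)%:R) * delta.

Definition hc (l : nat) : R :=
  (lam p)^-1 * (qc l + (qc 0)^-1 * qc (k - l)) +
  delta * (\sum_(1 <= r < (k - l).+1) qc (r + l) * Ac r
           - \sum_(maxn l.+1 zc <= i < ((l + k)./2).+1) qc (i.*2 - l)
           + \sum_(uphalf l <= i < (minn l zc.-1).+1) qc (i.*2 - l)).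

Definition admissible : Prop :=
  [/\ lam p - (lam p)^-1 = delta * (1 - Ac 0),
      forall l : nat, (1 <= l <= k.-1)%N -> hc l = 0 & beta = 0].

End Conditions.

Variant bgen := gY | gYinv | gX | gXinv | gE.

Definition bgen_code (g : bgen) : nat :=
  match g with gY => 0 | gYinv => 1 | gX => 2 | gXinv => 3 | gE => 4 end.
Definition bgen_decode (n : nat) : bgen :=
  match n with 0 => gY | 1 => gYinv | 2 => gX | 3 => gXinv | _ => gE end.
Fact bgen_codeK : cancel bgen_code bgen_decode. Proof. by case. Qed.
HB.instance Definition _ := Choice.copy bgen (can_type bgen_codeK).

Section Algebra.
Variables (R : comUnitRingType) (k : nat) (p : params R k).

Definition free_alg := {malg R[{fmonom bgen}]}.
Definition fvar (g : bgen) : free_alg := << fmu g >>.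

Local Notation Y := (fvar gY).
Local Notation Y' := (fvar gYinv).
Local Notation X := (fvar gX).
Local Notation X' := (fvar gXinv).
Local Notation e := (fvar gE).

(* brel a b : the relation a = b is imposed in B_2^k(R). *)
Variant brel : free_alg -> free_alg -> Prop :=
| BrelYYi : brel (Y * Y') 1
| BrelYiY : brel (Y' * Y) 1
| BrelXXi : brel (X * X') 1
| BrelXiX : brel (X' * X) 1
| BrelYk : brel (Y ^+ k) (\sum_(i < k) qc p i *: Y ^+ i)
| BrelSkein : brel (X - X') (delta p *: (1 - e))
| BrelBraid : brel (X * Y * X * Y) (Y * X * Y * X)
| BrelXe : brel (X * e) (lam p *: e)
| BreleX : brel (e * X) (lam p *: e)
| BrelYXYe : brel (Y * X * Y * e) ((lam p)^-1 *: e)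
| BreleYXY : brel (e * Y * X * Y) ((lam p)^-1 *: e)
| BreleYme m : (m < k)%N -> brel (e * Y ^+ m * e) (Ac p m *: e).

Definition brel_diff (x : free_alg) : Prop :=
  exists a b, brel a b /\ x = a - b.

(* B_2^k(R).  It is only declared as a ring and as an R-module, because the
   algebra structures of the library require 1 != 0; the two lemmas below are
   the remaining laws of an R-algebra. *)
Definition B2 : Type := tsq brel_diff.
HB.instance Definition _ := GRing.PzRing.on B2.
HB.instance Definition _ := GRing.Lmodule.on B2.

Definition bvar (g : bgen) : B2 := tsq_pi brel_diff (fvar g).

Lemma B2_scalerAl (c : R) (x y : B2) : c *: (x * y) = (c *: x) * y.
Proof. exact: mulrA. Qed.

Lemma free_algAr (c : R) (x y : free_alg) : c *: (x * y) = x * (c *: y).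
Proof.
have scaleC (z : free_alg) : c *: z = z * c%:MP.
  rewrite -mul_malgC !malgM_def fgmulUg fgmulgU; apply: eq_bigr => m _.
  by rewrite mul1m mulm1 mulrC.
by rewrite !scaleC mulrA.
Qed.

Lemma B2_scalerAr (c : R) (x y : B2) : c *: (x * y) = x * (c *: y).
Proof.
elim/tsq_ind: x => x; elim/tsq_ind: y => y.
by rewrite -rmorphM -!tsq_piZ -rmorphM /= free_algAr.
Qed.

End Algebra.

Section ModuleV.
Variables (R : comUnitRingType) (k : nat) (p : params R k).

(* V = 'cV[R]_k with basis v_0, ..., v_{k-1} the standard column vectors, and
   a linear map V -> V is the matrix acting by left multiplication; lin_ext f
   is the one sending v_i to f i. *)
Definition vbasis (i : nat) : 'cV[R]_k := \col_(r < k) ((r : nat) == i)%:R.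
Definition lin_ext (f : nat -> 'cV[R]_k) : 'M[R]_k := \matrix_(r, c) f c r 0.

Definition YV : 'M[R]_k :=
  lin_ext (fun i => if (i.+1 < k)%N then vbasis i.+1
                    else \sum_(j < k) qc p j *: vbasis j).

Definition YVpow (s : int) : 'M[R]_k :=
  match s with Posz n => YV ^+ n | Negz n => invmx YV ^+ n.+1 end.

Definition vv (s : int) : 'cV[R]_k := YVpow s *m vbasis 0.

Fixpoint XVcol (i : nat) : 'cV[R]_k :=
  match i with
  | 0 => lam p *: vbasis 0
  | 1 => (lam p)^-1 *: (invmx YV *m vbasis 0)
  | (j.+1 as i').+1 =>
      invmx YV *m XVcol i' - delta p *: vv j
      + (delta p * Ac p i') *: (invmx YV *m vbasis 0)
  end.

Definition XV : 'M[R]_k := lin_ext XVcol.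
Definition EV : 'M[R]_k := lin_ext (fun i => Ac p i *: vbasis 0).

End ModuleV.

(* V (x) V is 'M[R]_k with v (x) w = v *m w^T, so that the coordinate of M on
   v_i (x) v_j is M i j. *)
Definition tens (R : comUnitRingType) (k : nat) (v w : 'cV[R]_k) : 'M[R]_k :=
  v *m w^T.

Definition Xi (R : comUnitRingType) (k : nat) : lmodType R :=
  ('M[R]_k * 'M[R]_k * 'M[R]_k)%type.

Section LinearExtension.
Variables (R : comUnitRingType) (k : nat).
Variables (f0 f1 f2 : 'I_k -> 'I_k -> Xi R k).

(* The linear map with v_{i,j} |-> f0 i j, u_{i,j} |-> f1 i j and
   w_{i,j} |-> f2 i j. *)
Definition Xi_ext (x : Xi R k) : Xi R k :=
  \sum_i \sum_j (x.1.1 i j *: f0 i j + x.1.2 i j *: f1 i j + x.2 i j *: f2 i j).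

Fact Xi_ext_linear : linear Xi_ext.
Proof.
move=> a x y; rewrite scaler_sumr -big_split; apply: eq_bigr => i _ /=.
rewrite scaler_sumr -big_split; apply: eq_bigr => j _ /=.
rewrite !mxE !scalerDl !scalerDr !scalerA.
by rewrite [RHS]addrACA; congr (_ + _); rewrite [RHS]addrACA.
Qed.
HB.instance Definition _ :=
  GRing.isLinear.Build R (Xi R k) (Xi R k) _ Xi_ext Xi_ext_linear.

End LinearExtension.

Section ModuleXi.
Variables (R : comUnitRingType) (k : nat) (p : params R k).

Definition xi0 (M : 'M[R]_k) : Xi R k := (M, 0, 0).
Definition xi1 (M : 'M[R]_k) : Xi R k := (0, M, 0).
Definition xi2 (M : 'M[R]_k) : Xi R k := (0, 0, M).

Definition vt (i j : int) : Xi R k := xi0 (tens (vv p i) (vv p j)).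
Definition ut (i j : int) : Xi R k := xi1 (tens (vv p i) (vv p j)).
Definition wt (i j : int) : Xi R k := xi2 (tens (vv p i) (vv p j)).

(* The image of v_i (x) v_j under F (x) 1. *)
Definition act0 (F : 'M[R]_k) (i j : nat) : Xi R k :=
  xi0 (tens (F *m vv p i) (vv p j)).

Definition Eu (i j : nat) : Xi R k :=
  xi0 (tens (vv p 0) (YV p ^+ j *m (XV p *m (YV p ^+ i *m vv p 0)))).
Definition Ew (i j : nat) : Xi R k :=
  xi0 (tens (vv p 0)
            (YV p ^+ j *m (XV p *m (YV p ^+ i *m (XV p *m vv p 0))))).

Definition Ebar : {linear Xi R k -> Xi R k} :=
  Xi_ext (fun i j => act0 (EV p) i j) (fun i j => Eu i j) (fun i j => Ew i j).

Definition Xbar : {linear Xi R k -> Xi R k} :=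
  Xi_ext (fun i j => act0 (XV p) i j)
         (fun i j => wt i j)
         (fun i j => ut i j + delta p *: wt i j
                     - (delta p * lam p) *: Ebar (ut i j)).

Definition Wbar (x : Xi R k) : Xi R k :=
  Xbar x - delta p *: x + delta p *: Ebar x.

(* Y X v_{i,j} in the value at w_{i,j} lies in Xi_0, where the action of Y is
   Y_V (x) 1. *)
Definition Ybar : {linear Xi R k -> Xi R k} :=
  Xi_ext (fun i j => act0 (YV p) i j)
         (fun i j => ut i.+1 j)
         (fun i j => Wbar (ut i j.+1) + delta p *: ut 1 (i + j)%N
                     - delta p *: act0 (YV p *m XV p) i j).

(* An action of B_2^k(R) on Xi making it a module, with the R-algebra structure
   of B_2^k(R) inducing the given R-module structure of Xi. *)
Definition is_B2_action (act : B2 p -> Xi R k -> Xi R k) : Prop :=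
  [/\ forall a b x, act a (act b x) = act (a * b) x,
      forall x, act 1 x = x,
      forall a x y, act a (x + y) = act a x + act a y,
      forall a b x, act (a + b) x = act a x + act b x &
      forall (c : R) a x, act (c *: a) x = c *: act a x].

End ModuleXi.

(* Main.v *)
From HB Require Import structures.
Require Import Defs.
From mathcomp Require Import all_boot all_order all_algebra.
From mathcomp Require Import finmap monalg.
From mathcomp Require Import zify ring.
Set Implicit Arguments.
Unset Strict Implicit.
Unset Printing Implicit Defensive.
Import GRing.Theory.
Local Open Scope ring_scope.

(** Let f(t) = sum over l <= k of q_l t^l, where q_k = -1.  As a module over
    its endomorphism Y_V, the space V is the ring R[y] / (f) with basis
    v_i = y^i, and y is invertible because q_0 is.  Everything below is read
    through this identification.  A tensor in V (x) V is a matrix M, on which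
    F (x) G acts by M |-> F M G^T; multiplication V (x) V -> V is the linear
    map [Vmul], which turns both y (x) 1 and 1 (x) y into multiplication by y;
    the form v_i |-> A_i is the row [Arow] and E_V = 1 . Arow.

    V itself satisfies the relations, in the sharper form Y X Y = W and
    X W = W X = 1 with W = X - delta + delta E.  The definition of X_V
    makes Y X Y and W agree on v_0, ..., v_{k-2}.  Agreement on v_{k-1}
    is one more vector equation, a sum of multiples of powers of y, and its
    coefficients are the h_l and beta once multiples of f(y) are discarded
    ([admissible_laurent]; the index bookkeeping is
    [admissible_cancellation]).  Next, the defects T = X W - 1 and
    F = E X - lambda E satisfy T Y = Y T - delta F Y, so T is determined by F;
    since T kills f(y) v_0 = 0 and delta is not a zero divisor, a triangular
    argument gives F = 0 ([Arow_XV]), and then T = 0 ([XV_WV]).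

    On Xi write u(M), w(M) for the elements xi1 M, xi2 M.  The maps are
    Ebar u(M) = 1 (x) Vmul(X M), Xbar u(M) = w(M), and so on ([Ebar1],
    [Xbar2], [Ybar2], ...), so two linear maps need only be compared on the
    three summands.  The quadratic relation
    Xbar^2 = 1 + delta Xbar - delta lambda Ebar ([Xbar_sq]) amounts to
    Xbar Wbar = 1.  For P = Ybar Xbar Ybar, a computation gives P u and P w in
    closed form ([YXY1], [YXY2]), from which P Xbar = Xbar P on u.  On
    w = Xbar u the same follows from the quadratic relation and
    P Ebar = Ebar P = lambda^-1 Ebar ([braid_on_image]).

    The polynomial relation f(Ybar) = 0 is immediate on u and on Xi_0.  On w,
    Ybar w(M) = w(M y^T) + g with g in the two other summands, and f(Ybar) w(M)
    is the divided difference (f(y (x) 1) - f(1 (x) y)) / (y (x) 1 - 1 (x) y)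
    applied to g.  That operator cannot tell y (x) 1 from 1 (x) y, so it
    factors through Vmul ([divdiff_sum_mu]), and Vmul kills both components of
    g.

    Finally f(Ybar) = 0 with q_0 invertible makes Ybar invertible, words in the
    generators act on Xi, and the relations show that this action of the free
    algebra kills the two-sided ideal defining B_2^k(R). *)

(** * Sums over ranges of natural numbers *)

Section Sums.
Variable V : nmodType.

Lemma big_nat_mulrb (F : nat -> V) m n N : (n <= N)%N ->
  \sum_(m <= i < n) F i = \sum_(0 <= i < N) F i *+ (m <= i < n)%N.
Proof.
move=> le_nN; rewrite (big_nat_widenl m 0) // (big_nat_widen _ _ _ _ _ le_nN).
by rewrite big_mkcond; apply: eq_bigr => i _; rewrite mulrb.
Qed.

Lemma sum_nat_mulrb_pred1 (F : nat -> V) (P : nat -> bool) j N :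
  (forall i, P i -> i = j) -> (P j -> (j < N)%N) ->
  \sum_(0 <= i < N) F i *+ P i = F j *+ P j.
Proof.
move=> Pj ltjN; have [Pjj|nPj] := boolP (P j).
  have -> : \sum_(0 <= i < N) F i *+ P i = \sum_(0 <= i < N | i == j) F i.
    rewrite [RHS]big_mkcond; apply: eq_bigr => i _; rewrite mulrb.
    case: eqVneq => [-> //|nij]; first by rewrite Pjj.
    by case: ifP => // /Pj/eqP; rewrite (negPf nij).
  by rewrite big_nat1_eq ltjN.
rewrite mulr0n big1 // => i _; case: (boolP (P i)) => // Pi.
by case/negP: nPj; rewrite -(Pj i).
Qed.

End Sums.

(** Closes a goal that follows from one known equation by linear rearrangement:
    the difference of the two equations is left to [ring]. *)
Lemma eq_of_subr_eq (W : zmodType) (a b c d : W) : a - b = c - d -> c = d -> a = b.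
Proof. by move=> abcd cd; apply/subr0_eq; rewrite abcd cd subrr. Qed.

(** * The Laurent polynomial identity behind admissibility *)

Section Laurent.
Variables (R : comUnitRingType) (k : nat) (p : params R k).
Variables (V : lmodType R) (e : int -> V).

Local Notation C i l := (qc p l *: e (l%:Z - (i + i)%:Z)).
Local Notation "\SS_ i F" := (\sum_(0 <= i < k.+1) F)
  (at level 41, i at level 0, F at level 41).

Lemma qc_k : qc p k = -1.
Proof. by rewrite /qc nth_rcons size_tuple ltnn eqxx. Qed.

(** The double sums in h_l run over s and i with weight q_{2i-s}; with l = 2i - s
    every term becomes q_l e(l - 2i), the form in which the relation
    sum_l q_l e(n + l) = 0 can be applied for each fixed i. *)
Lemma antidiagonal_sum (P : nat -> nat -> bool) :
    (forall s i, P s i -> (s <= k) && (s <= i + i <= s + k))%N ->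
  \SS_ s (\SS_ i qc p (i.*2 - s)%N *+ P s i) *: e (- s%:Z) =
  \SS_ i \SS_ l C i l *+ ((l <= i + i) && P (i + i - l) i)%N.
Proof.
move=> hP.
transitivity (\SS_ s \SS_ i \SS_ l C i l *+ ((l + s == i + i) && P s i)%N).
  apply: eq_bigr => s _; rewrite scaler_suml; apply: eq_bigr => i _.
  rewrite (@sum_nat_mulrb_pred1 _ _ _ (i + i - s)%N); last 2 first.
  - by move=> l /andP[]; lia.
  - by case/andP=> _ /hP; lia.
  rewrite -scalerMnl -addnn.
  have [/hP si|] := boolP (P s i); last by rewrite andbF !mulr0n.
  have -> : (i + i - s + s == i + i)%N by lia.
  by congr (_ *: e _ *+ _); lia.
rewrite exchange_big; apply: eq_bigr => i _ /=.
rewrite exchange_big; apply: eq_big_nat => l lk /=.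
have [le_l2i|gt_l2i] := leqP l (i + i); last first.
  by rewrite big1 // => s _; rewrite (_ : (_ == _) = false) //; lia.
have [P2i|nP2i] /= := boolP (P _ _).
  rewrite (@sum_nat_mulrb_pred1 _ _ _ (i + i - l)%N) ?P2i ?andbT.
  - by rewrite subnKC ?eqxx.
  - by move=> s /andP[]; lia.
  - by move/hP: P2i; lia.
rewrite big1 // => s _; case: (boolP (_ && _)) => // /andP[/eqP ls].
by rewrite (_ : s = i + i - l)%N ?(negPf nP2i) //; lia.
Qed.

Hypothesis k_gt0 : (0 < k)%N.
Hypothesis charE :
  forall n : int, \SS_ l qc p l *: e (l%:Z + n) = 0.

(** All four double sums are written over the same terms q_l e(l - 2i), so it
    suffices to compare multiplicities.  For i >= z they cancel except at
    l = k = 2i, which exists for even k and gives the e 0 on the right; for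
    0 < i < z every l occurs once, which gives a multiple of the relation. *)
Lemma admissible_cancellation :
  \SS_ s (qc p s *+ (0 < s)%N) *: e (- s%:Z)
  + \SS_ s (\SS_ i qc p (i.*2 - s)%N *+
       [&& 0 < s < k & maxn s.+1 (zc k) <= i < ((s + k)./2).+1]%N) *: e (- s%:Z)
  = \SS_ s (\SS_ i qc p (i.*2 - s)%N *+
       [&& 0 < s < k & uphalf s <= i < (minn s (zc k).-1).+1]%N) *: e (- s%:Z)
  + \SS_ l \SS_ i qc p l *: e (l%:Z - (i + i)%:Z) *+ (0 < i <= l)%N
  + (1 - (odd k)%:R) *: e 0.
Proof.
rewrite !antidiagonal_sum; [|by lia|by rewrite /zc; lia].
have diag : \SS_ s (qc p s *+ (0 < s)%N) *: e (- s%:Z) =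
    \SS_ i \SS_ l C i l *+ ((l == i) && (0 < i))%N.
  apply: eq_big_nat => i /andP[_ lt_ik].
  rewrite (@sum_nat_mulrb_pred1 _ _ _ i) ?eqxx //; last by lia.
  by rewrite -scalerMnl; congr (_ *: e _ *+ _); lia.
have middle : \SS_ i \SS_ l C i l *+ ((l == k) && (i + i == k))%N =
    - ((1 - (odd k)%:R) *: e 0).
  case: (boolP (odd k)) => odd_k.
    rewrite subrr scale0r oppr0 big1 // => i _; rewrite big1 // => l _.
    by rewrite (_ : _ && _ = false) //; lia.
  rewrite subr0 scale1r -scaleN1r -qc_k.
  rewrite exchange_big /=.
  rewrite (eq_bigr (fun l => (\SS_ i C i l *+ (i + i == k)%N) *+ (l == k))); last first.
    by move=> l _; rewrite -sumrMnl; apply: eq_bigr => i _; rewrite -mulrnA mulnC mulnb.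
  rewrite (@sum_nat_mulrb_pred1 _ _ _ k) ?eqxx => [|i /eqP|] //.
  rewrite (@sum_nat_mulrb_pred1 _ _ _ k./2); [|lia..].
  rewrite (_ : (_ == _)%N = true); last by lia.
  by congr (_ *: e _); lia.
have periods : \SS_ i \SS_ l C i l *+ (0 < i < zc k)%N = 0.
  by apply: big1 => i _; rewrite sumrMnl charE mul0rn.
rewrite diag [X in _ = _ + X + _]exchange_big /=.
rewrite -[LHS]addr0 -[X in _ + X = _]periods.
apply/eqP; rewrite -subr_eq -middle; apply/eqP.
rewrite -!big_split; apply: eq_big_nat => i /andP[_ lt_ik] /=.
rewrite -!big_split; apply: eq_big_nat => l /andP[_ lt_lk] /=.
rewrite -!mulrnDr; congr (_ *+ _).
have z2 : ((zc k).*2 = k + odd k)%N by rewrite /zc; lia.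
have -> : [&& l <= i + i, 0 < i + i - l < k, maxn (i + i - l).+1 (zc k) <= i
    & i < ((i + i - l + k)./2).+1]%N = [&& zc k <= i, i < l & l < i + i]%N.
  by apply/idP/idP; lia.
have -> : [&& l <= i + i, 0 < i + i - l < k, uphalf (i + i - l) <= i
    & i < (minn (i + i - l) (zc k).-1).+1]%N = [&& 0 < i, i < zc k & l <= i]%N.
  by apply/idP/idP; lia.
have [i0|i_gt0] := posnP i; first by rewrite i0 /=; lia.
have [li|il|eli] := ltngtP l i; have [iz|zi] := ltnP i (zc k) => /=; lia.
Qed.

Local Notation lm := (lam p).
Local Notation q0 := (qc p 0).
Local Notation d := (delta p).

Lemma delta_Ac0 : param_conditions p -> d * Ac p 0 = d - lm + lm^-1.
Proof. by case=> _ _ _ h _; apply: (eq_of_subr_eq _ h); ring. Qed.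

(** The coefficient of v_{-s} in [admissible_laurent], rewritten with h_s = 0 for
    0 < s < k, with beta = 0 for s = 0, and directly for s = k. *)
Lemma admissible_coef s : param_conditions p -> admissible p -> (s <= k)%N ->
  lm * qc p s + d * ((\sum_(0 <= r < (k - s).+1) qc p (r + s) * Ac p r)
                       *+ (0 < s)%N) =
  d * (qc p s *+ (0 < s)%N)
  + d * ((\SS_ i qc p (i.*2 - s)%N *+
       [&& 0 < s < k & maxn s.+1 (zc k) <= i < ((s + k)./2).+1]%N)
     - (\SS_ i qc p (i.*2 - s)%N *+
       [&& 0 < s < k & uphalf s <= i < (minn s (zc k).-1).+1]%N))
  - lm^-1 * q0^-1 * qc p (k - s)%N
  - ((1 - (odd k)%:R) * d) *+ (s == 0)%N.
Proof.
move=> hp [_ hh hb] le_sk; have A0E := delta_Ac0 hp.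
case: hp => q0U _ lmU _ _.
have lmK := mulVr lmU; have q0K := mulVr q0U.
have [s0|s_gt0] := posnP s.
  rewrite s0 /= !mulr0n !mulr0 subn0 qc_k.
  rewrite !big1 //=; apply: (eq_of_subr_eq _ hb); rewrite /beta; ring.
rewrite !mulr1n mulr0n subr0.
rewrite big_nat_recl // add0n mulrDr [d * (_ * Ac p 0)]mulrCA A0E.
have [lt_sk|ge_sk] := ltnP s k; last first.
  have -> : s = k by lia.
  rewrite subnn big_geq // !big1 // subrr !mulr0 !addr0 qc_k.
  by rewrite -mulrA q0K; ring.
have := hh s; rewrite /hc => /(_ ltac:(lia)).
rewrite big_add1 /= => h.
rewrite [X in _ + d * (X - _) + _](_ : _ =
    \sum_(maxn s.+1 (zc k) <= i < ((s + k)./2).+1) qc p (i.*2 - s)); last first.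
  by rewrite [RHS](@big_nat_mulrb _ _ _ _ k.+1) ?s_gt0 ?lt_sk //; lia.
rewrite [X in _ + d * (_ - X) + _](_ : _ =
    \sum_(uphalf s <= i < (minn s (zc k).-1).+1) qc p (i.*2 - s)); last first.
  by rewrite [RHS](@big_nat_mulrb _ _ _ _ k.+1) ?s_gt0 ?lt_sk //; lia.
apply: (eq_of_subr_eq _ h); ring.
Qed.

(** The summand for l is q_l times the value that the recursion for X_V would give
    at v_l, when e n = y^n: thus the sum says that X_V obeys its recursion at
    v_k as well. *)
Lemma admissible_laurent : param_conditions p -> admissible p ->
  \SS_ l qc p l *: (lm *: e (- l%:Z)
     + d *: \sum_(1 <= s < l.+1) (Ac p (l - s) *: e (- s%:Z)
                                  - e (l%:Z - (s + s)%:Z))) = 0.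
Proof.
move=> hp hadm.
have A_part : \SS_ l qc p l *: \sum_(1 <= s < l.+1) Ac p (l - s) *: e (- s%:Z) =
    \SS_ s ((\sum_(0 <= r < (k - s).+1) qc p (r + s) * Ac p r) *+ (0 < s)%N)
      *: e (- s%:Z).
  transitivity (\SS_ s \SS_ l (qc p l * Ac p (l - s)) *: e (- s%:Z) *+ (0 < s <= l)%N).
    rewrite exchange_big; apply: eq_big_nat => l lk /=.
    rewrite (@big_nat_mulrb _ _ _ _ k.+1) // scaler_sumr.
    by apply: eq_bigr => s _; rewrite -scalerMnr scalerA.
  apply: eq_big_nat => s sk; rewrite -scalerMnl scaler_suml -sumrMnl.
  rewrite [LHS](@big_cat_nat _ _ _ s) /=; [|lia..].
  rewrite big_nat_cond big1 ?add0r; last first.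
    by move=> l /andP[/andP[_ ls] _]; rewrite [_ && _](_ : _ = false) //; lia.
  rewrite -{1}[s]add0n big_addn subSn; last by lia.
  by apply: eq_bigr => r _; rewrite addnK leq_addl andbT.
have T_part : \SS_ l qc p l *: \sum_(1 <= s < l.+1) e (l%:Z - (s + s)%:Z) =
    \SS_ l \SS_ i qc p l *: e (l%:Z - (i + i)%:Z) *+ (0 < i <= l)%N.
  apply: eq_big_nat => l lk; rewrite (@big_nat_mulrb _ _ _ _ k.+1) // scaler_sumr.
  by apply: eq_bigr => i _; rewrite -scalerMnr.
have rev_part : \SS_ s qc p (k - s)%N *: e (- s%:Z) = 0.
  rewrite -[RHS](charE (- k%:Z)) big_nat_rev /=; apply: eq_big_nat => s sk.
  by congr (qc p _ *: e _); lia.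
transitivity (\SS_ s (lm * qc p s + d * ((\sum_(0 <= r < (k - s).+1) qc p (r + s) * Ac p r)
                       *+ (0 < s)%N)) *: e (- s%:Z)
    - d *: \SS_ l \SS_ i qc p l *: e (l%:Z - (i + i)%:Z) *+ (0 < i <= l)%N).
  rewrite -T_part.
  under [X in X - _]eq_bigr do rewrite scalerDl -!scalerA.
  rewrite big_split /= -!scaler_sumr -A_part.
  under [LHS]eq_bigr do rewrite sumrB.
  rewrite !scaler_sumr -big_split -sumrB /=; apply: eq_bigr => l _.
  by rewrite !(scalerDr, scalerN) !scalerA addrA ![qc p l * _]mulrC.
under eq_big_nat => s sk do rewrite admissible_coef //.
under eq_bigr do rewrite 2!scalerBl scalerDl [d * (_ - _)]mulrBr scalerBl.
rewrite 2!sumrB big_split sumrB /=.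
under [X in _ - X - _ - _]eq_bigr do rewrite -scalerA.
rewrite -scaler_sumr rev_part scaler0 subr0.
under [X in _ - X - _]eq_bigr do rewrite -scalerMnl.
rewrite (@sum_nat_mulrb_pred1 _ _ _ 0) /= ?mulr1n ?oppr0; [|by move=> ? /eqP| by []].
have := admissible_cancellation => H.
have : forall f : nat -> R, \SS_ s (d * f s) *: e (- s%:Z) = d *: \SS_ s f s *: e (- s%:Z).
  by move=> f; rewrite scaler_sumr; apply: eq_bigr => s _; rewrite scalerA.
move=> dE; rewrite !dE [_ * d]mulrC -scalerA -!scalerBr -scalerDr -!scalerBr addrA H.
rewrite -3!addrA -!opprD ?addrA [X in _ - X]addrAC subrr scaler0 //.
Qed.

End Laurent.

(** * The module V *)

Section ModuleV.
Variables (R : comUnitRingType) (k : nat) (p : params R k).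
Hypothesis k_gt0 : (0 < k)%N.
Hypothesis hp : param_conditions p.

Local Notation lm := (lam p).
Local Notation q0 := (qc p 0).
Local Notation d := (delta p).
Local Notation y := (YV p).
Local Notation x := (XV p).
Local Notation v := (vv p).

Lemma lin_extE (f : nat -> 'cV[R]_k) i : (i < k)%N ->
  lin_ext f *m Defs.vbasis R k i = f i.
Proof.
move=> lt_ik; apply/colP => r; rewrite mxE (bigD1 (Ordinal lt_ik)) //= !mxE eqxx mulr1.
rewrite big1 ?addr0 // => j ne_ji; rewrite !mxE.
by case: eqP => [ji|_]; [case/eqP: ne_ji; apply: val_inj | rewrite mulr0].
Qed.

Lemma expmxS (M : 'M[R]_k) n : M ^+ n.+1 = M *m M ^+ n.
Proof. exact: exprS. Qed.

Lemma vv_basis i : (i < k)%N -> v i%:Z = Defs.vbasis R k i.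
Proof.
rewrite /vv /=; elim: i => [|i IHi] lt_ik; first by rewrite expr0 mul1mx.
by rewrite expmxS -mulmxA IHi ?lin_extE ?lt_ik //; lia.
Qed.

Lemma vbasis_mx m (M : 'M[R]_(m, k)) (i : 'I_k) : M *m Defs.vbasis R k i = col i M.
Proof.
apply/colP => r; rewrite !mxE (bigD1 i) //= !mxE eqxx mulr1 big1 ?addr0 // => j ne_ji.
by rewrite !mxE -val_eqE in ne_ji *; rewrite (negPf ne_ji) mulr0.
Qed.

Lemma eq_mx_vv m (M N : 'M[R]_(m, k)) :
  (forall i, (i < k)%N -> M *m v i%:Z = N *m v i%:Z) -> M = N.
Proof.
move=> MN; apply/matrixP => r i.
by move/colP/(_ r): (MN i (ltn_ord i)); rewrite !vv_basis // !vbasis_mx !mxE.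
Qed.

Lemma vv_S (n : nat) : v n.+1%:Z = y *m v n%:Z.
Proof. by rewrite /vv /= expmxS -mulmxA. Qed.

(** This is the definition of Y_V on the last basis vector. *)
Lemma vv_char0 : \sum_(0 <= l < k.+1) qc p l *: v l%:Z = 0.
Proof.
rewrite big_nat_recr //= qc_k scaleN1r -[X in v X%:Z](prednK k_gt0) vv_S.
rewrite vv_basis ?lin_extE ?prednK // ltnn big_mkord; apply/eqP.
rewrite subr_eq0; apply/eqP.
by apply: eq_bigr => i _; rewrite vv_basis.
Qed.

Lemma YV_comm_pow n : y *m y ^+ n = y ^+ n *m y.
Proof. exact: (commrX n (erefl (y * y))). Qed.

Lemma YV_char : \sum_(0 <= l < k.+1) qc p l *: y ^+ l = 0.
Proof.
apply: eq_mx_vv => i _; rewrite mul0mx.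
have -> : v i%:Z = y ^+ i *m v 0 by rewrite /vv /= expr0 mul1mx.
rewrite mulmxA.
have -> : (\sum_(0 <= l < k.+1) qc p l *: y ^+ l) *m y ^+ i =
    y ^+ i *m \sum_(0 <= l < k.+1) qc p l *: y ^+ l.
  rewrite mulmx_suml mulmx_sumr; apply: eq_bigr => l _.
  by rewrite -scalemxAl -scalemxAr !mulmxE -!exprD addnC.
rewrite -mulmxA mulmx_suml (eq_bigr (fun l => qc p l *: v l%:Z)) ?vv_char0 ?mulmx0 //.
by move=> l _; rewrite -scalemxAl /vv /= expr0 mul1mx.
Qed.

Lemma YV_unit : y \in unitmx.
Proof.
case: hp => q0U _ _ _ _.
have : y *m (- q0^-1 *: \sum_(0 <= l < k) qc p l.+1 *: y ^+ l) = 1%:M.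
  rewrite -scalemxAr mulmx_sumr; have := YV_char; rewrite big_nat_recl // expr0.
  under eq_bigr do rewrite exprS scalemxAr.
  move/eqP; rewrite addrC addr_eq0 => /eqP ->.
  by rewrite scaleNr scalerN opprK scalerA mulVr // scale1r.
by case/mulmx1_unit.
Qed.

Lemma YV_vv n : y *m v n = v (n + 1).
Proof.
case: n => [n|n]; first by rewrite -vv_S; congr v; lia.
have -> : Negz n + 1 = - n%:Z by lia.
case: n => [|n]; first by rewrite /vv /= expr0 mul1mx expr1 mulKVmx ?YV_unit.
by rewrite [v (Negz _)]/vv /= expmxS -mulmxA mulKVmx ?YV_unit.
Qed.

Lemma YVinv_vv n : invmx y *m v n = v (n - 1).
Proof. by rewrite -[n in LHS](subrK 1) -YV_vv mulKmx ?YV_unit. Qed.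

Lemma YVX_vv m n : y ^+ m *m v n = v (n + m%:Z).
Proof.
elim: m => [|m IHm]; first by rewrite expr0 mul1mx addr0.
by rewrite expmxS -mulmxA IHm YV_vv; congr v; lia.
Qed.

Lemma vv_char (n : int) : \sum_(0 <= l < k.+1) qc p l *: v (l%:Z + n) = 0.
Proof.
transitivity ((0 : 'M_k) *m v n); last by rewrite mul0mx.
rewrite -YV_char mulmx_suml.
by apply: eq_bigr => l _; rewrite -scalemxAl YVX_vv addrC.
Qed.

Definition Arow : 'rV[R]_k := \row_i Ac p i.

Lemma Arow_vv i : (i < k)%N -> Arow *m v i%:Z = (Ac p i)%:M.
Proof.
move=> lt_ik; rewrite vv_basis // (vbasis_mx _ (Ordinal lt_ik)).
by apply/rowP=> j; rewrite !mxE !ord1 eqxx mulr1n.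
Qed.

Lemma EV_vv i : (i < k)%N -> EV p *m v i%:Z = Ac p i *: v 0.
Proof. by move=> lt_ik; rewrite vv_basis // lin_extE // vv_basis. Qed.

Lemma EVE : EV p = v 0 *m Arow.
Proof.
apply: eq_mx_vv => i lt_ik.
by rewrite EV_vv // -mulmxA Arow_vv // mul_mx_scalar.
Qed.

(** The action on V of the inverse generator of X, as the skein relation forces it. *)
Definition WV := x - d%:M + d *: EV p.

(** The recursion defining X_V on basis vectors, solved and extended to all l. *)
Definition XVval l : 'cV[R]_k := lm *: v (- l%:Z)
     + d *: \sum_(1 <= s < l.+1) (Ac p (l - s) *: v (- s%:Z)
                                  - v (l%:Z - (s + s)%:Z)).

Lemma XVval_S l : XVval l.+1 = invmx y *m (XVval l - d *: v l%:Z + (d * Ac p l) *: v 0).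
Proof.
rewrite /XVval big_nat_recl // !mulmxDr mulmxN -!scalemxAr mulmx_sumr !YVinv_vv.
rewrite -!addrA; congr (_ *: v _ + _); first by lia.
rewrite [LHS]scalerDr [X in _ + X = _]scalerDr scalerN scalerA [LHS]addrA.
rewrite [RHS]addrC [X in _ = X + _]addrC.
congr ((_ * Ac p _) *: v _ - _ *: v _ + _ *: _); [lia..|].
apply: eq_big_nat => s sl.
by rewrite mulmxBr -scalemxAr !YVinv_vv; congr (Ac p _ *: v _ - v _); lia.
Qed.

Lemma XVval_1 : XVval 1 = lm^-1 *: v (-1).
Proof.
rewrite XVval_S /XVval big_geq // scaler0 addr0 oppr0 -scalerBl -scalerDl.
by rewrite delta_Ac0 // -scalemxAr YVinv_vv sub0r; congr (_ *: _); ring.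
Qed.

Lemma XV_vv_lt i : (i < k)%N -> x *m v i%:Z = XVval i.
Proof.
move=> lt_ik; rewrite vv_basis // lin_extE //.
elim: i lt_ik => [_|i IHi lt_ik].
  by rewrite [LHS]/= -(vv_basis k_gt0) /XVval big_geq // scaler0 addr0 oppr0.
case: i IHi lt_ik => [_ _|i IHi lt_ik].
  by rewrite XVval_1 /= -(vv_basis k_gt0) YVinv_vv.
rewrite XVval_S -IHi; last by lia.
rewrite [LHS]/= -/(XVcol p i.+1).
rewrite -(vv_basis k_gt0) 2!mulmxDr mulmxN -!scalemxAr !YVinv_vv.
by congr (_ - _ *: v _ + _); lia.
Qed.

Hypothesis hadm : admissible p.

(** At i = k both sides are determined by the values at i < k, the left one by
    linearity and the right one by [admissible_laurent]. *)
Lemma XV_vv i : (i <= k)%N -> x *m v i%:Z = XVval i.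
Proof.
rewrite leq_eqVlt => /orP[/eqP->|]; last exact: XV_vv_lt.
have := admissible_laurent k_gt0 vv_char hp hadm.
rewrite big_nat_recr //= qc_k scaleN1r -/(XVval k).
move/eqP; rewrite subr_eq0 => /eqP <-.
have := vv_char0; rewrite big_nat_recr //= qc_k scaleN1r.
move/eqP; rewrite subr_eq0 => /eqP <-.
rewrite mulmx_sumr; apply: eq_big_nat => l /andP[_ lt_lk].
by rewrite -scalemxAr XV_vv_lt.
Qed.

Lemma YXY_V : y *m x *m y = WV.
Proof.
apply: eq_mx_vv => i lt_ik; rewrite -!mulmxA -vv_S XV_vv // XVval_S mulKVmx ?YV_unit //.
rewrite !(mulmxDl, mulNmx) mul_scalar_mx -scalemxAl EV_vv // scalerA.
by rewrite XV_vv // ltnW.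
Qed.

Lemma XV_v0 : x *m v 0 = lm *: v 0.
Proof. by rewrite (XV_vv (leq0n k)) /XVval big_geq // scaler0 addr0 oppr0. Qed.

Lemma WV_v0 : WV *m v 0 = lm^-1 *: v 0.
Proof.
rewrite !mulmxDl mulNmx mul_scalar_mx -scalemxAl EV_vv // scalerA XV_v0.
by rewrite -scalerBl -scalerDl delta_Ac0 //; congr (_ *: _); ring.
Qed.

Lemma XV_EV : x *m EV p = lm *: EV p.
Proof. by rewrite EVE mulmxA XV_v0 -scalemxAl. Qed.

Lemma delta_cancel m n (M : 'M[R]_(m, n)) : d *: M = 0 -> M = 0.
Proof.
case: hp => _ _ _ _ d_reg dM; apply/matrixP => i j; apply: d_reg.
by move/matrixP/(_ i j): dM; rewrite !mxE mulr0.
Qed.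

(* T and v_0 f are the failures of X W = 1 and of E X = lambda E. *)
Let T : 'M[R]_k := x *m WV - 1%:M.
Let f : 'rV[R]_k := Arow *m x - lm *: Arow.
Let fc j : R := (f *m v j%:Z) 0 0.

(** Both sides compare W X Y = Y X W, which follows from Y X Y = W, with the
    difference W X - X W = delta (E X - lambda E). *)
Lemma defect_comm : T *m y = y *m T - d *: (v 0 *m f *m y).
Proof.
have WXE : WV *m x = x *m WV + d *: (v 0 *m f).
  rewrite /WV mulmxDr mulmxDl mulmxBl mulmxBr -scalemxAl -scalemxAr XV_EV.
  rewrite mul_scalar_mx mul_mx_scalar -[RHS]addrA; congr (_ + _).
  by rewrite -scalerDr {2}EVE /f mulmxBr -scalemxAr mulmxA -EVE addrC subrK.
have WXY : WV *m x *m y = y *m (x *m WV) by rewrite -YXY_V !mulmxA.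
rewrite /T mulmxBl mulmxBr mul1mx mulmx1 -WXY WXE mulmxDl -scalemxAl.
by rewrite addrAC addrK.
Qed.

Lemma defect_vv i : T *m v i%:Z =
  - (d *: \sum_(1 <= j < i.+1) fc j *: v (i%:Z - j%:Z)).
Proof.
elim: i => [|i IHi].
  rewrite big_geq // scaler0 oppr0 mulmxBl mul1mx -mulmxA WV_v0 -scalemxAr XV_v0.
  by case: hp => _ _ lmU _ _; rewrite scalerA mulVr // scale1r subrr.
rewrite vv_S mulmxA defect_comm mulmxBl -scalemxAl -!mulmxA IHi -vv_S.
rewrite [f *m _]mx11_scalar mul_mx_scalar -/(fc i.+1).
rewrite mulmxN -scalemxAr mulmx_sumr -opprD -scalerDr; congr (- (_ *: _)).
rewrite [RHS]big_nat_recr //= subrr; congr (_ + _); last by rewrite -scalemxAr.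
apply: eq_bigr => j _; rewrite -scalemxAr YV_vv; congr (_ *: v _); lia.
Qed.

(** Apply T to f(y) v_0 = 0 and divide by delta.  The coefficient of v_{k-j} in the
    result is q_k f_j = - f_j plus terms in f_1, ..., f_{j-1}. *)
Lemma defect_coef j : (0 < j <= k)%N -> fc j = 0.
Proof.
have Tsum : \sum_(0 <= l < k.+1) qc p l *:
    \sum_(1 <= j < l.+1) fc j *: v (l%:Z - j%:Z) = 0.
  apply: delta_cancel; rewrite scaler_sumr.
  transitivity (- (T *m \sum_(0 <= l < k.+1) qc p l *: v l%:Z)); last first.
    by rewrite vv_char0 mulmx0 oppr0.
  rewrite mulmx_sumr -sumrN; apply: eq_bigr => l _.
  by rewrite -scalemxAr defect_vv scalerN opprK !scalerA mulrC.
elim/ltn_ind: j => j IHj /andP[j_gt0 le_jk].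
have lt_kj : (k - j < k)%N by lia.
have := congr1 (fun w : 'cV_k => w (Ordinal lt_kj) 0) Tsum.
rewrite mxE summxE big_nat_recr //= qc_k.
rewrite big_nat_cond big1 ?add0r => [|l /andP[/andP[_ lt_lk] _]]; last first.
  rewrite mxE summxE big_nat_cond big1 ?mulr0 // => i /andP[/andP[i_gt0 le_il] _].
  rewrite mxE; have [lt_ij|ge_ij] := ltnP i j.
    by rewrite IHj ?mul0r // i_gt0 (leq_trans (ltnW lt_ij)).
  have -> : l%:Z - i%:Z = (l - i)%N%:Z by lia.
  rewrite vv_basis; last by lia.
  by rewrite mxE /= (_ : _ == _ = false) ?mulr0 //; lia.
(* Only the term of index j in the summand l = k is left. *)
rewrite scaleN1r mxE summxE (big_cat_nat (n := j)) //=; last by lia.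
rewrite big_nat_cond big1 ?add0r => [|i /andP[/andP[i_gt0 lt_ij] _]]; last first.
  by rewrite mxE IHj ?mul0r // i_gt0; lia.
rewrite big_ltn; last by lia.
rewrite big_nat_cond big1 ?addr0 => [|i /andP[/andP[lt_ji le_ik] _]]; last first.
  have -> : k%:Z - i%:Z = (k - i)%N%:Z by lia.
  rewrite vv_basis; last by lia.
  by rewrite !mxE /= (_ : _ == _ = false) ?mulr0 //; lia.
have -> : k%:Z - j%:Z = (k - j)%N%:Z by lia.
rewrite vv_basis // !mxE eqxx mulr1 => /eqP.
by rewrite oppr_eq0 => /eqP.
Qed.

Lemma Arow_XV : Arow *m x = lm *: Arow.
Proof.
apply: subr0_eq; apply: eq_mx_vv => i lt_ik; rewrite mul0mx.
rewrite [LHS]mx11_scalar -/f -/(fc i).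
case: (posnP i) => [->|i_gt0]; last by rewrite defect_coef ?raddf0 // i_gt0 ltnW.
rewrite /fc /f mulmxBl -mulmxA XV_v0 -scalemxAr -scalemxAl subrr mxE.
by rewrite raddf0.
Qed.

Lemma XV_WV : x *m WV = 1%:M.
Proof.
suff T0 : T = 0 by apply/eqP; rewrite -subr_eq0 -/T T0.
apply: eq_mx_vv => i _; rewrite defect_vv /fc /f Arow_XV subrr mul0mx.
by rewrite big1 ?scaler0 ?oppr0 ?mul0mx // => j _; rewrite mul0mx mxE scale0r.
Qed.

End ModuleV.

(** * Linear maps on Xi *)

Section XiComponents.
Variables (R : comUnitRingType) (k : nat).

Lemma eq_Xi (z w : Xi R k) :
  z.1.1 = w.1.1 -> z.1.2 = w.1.2 -> z.2 = w.2 -> z = w.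
Proof. by case: z w => [[? ?] ?] [[? ?] ?] /= -> -> ->. Qed.

Fact xi0_is_linear : linear (@xi0 R k).
Proof. by move=> a M N; apply: eq_Xi; rewrite //= scaler0 addr0. Qed.
Fact xi1_is_linear : linear (@xi1 R k).
Proof. by move=> a M N; apply: eq_Xi; rewrite //= scaler0 addr0. Qed.
Fact xi2_is_linear : linear (@xi2 R k).
Proof. by move=> a M N; apply: eq_Xi; rewrite //= scaler0 addr0. Qed.
HB.instance Definition _ := GRing.isLinear.Build R 'M[R]_k (Xi R k) _ (@xi0 R k) xi0_is_linear.
HB.instance Definition _ := GRing.isLinear.Build R 'M[R]_k (Xi R k) _ (@xi1 R k) xi1_is_linear.
HB.instance Definition _ := GRing.isLinear.Build R 'M[R]_k (Xi R k) _ (@xi2 R k) xi2_is_linear.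

Lemma Xi_split (z : Xi R k) : z = xi0 z.1.1 + xi1 z.1.2 + xi2 z.2.
Proof. by apply: eq_Xi; rewrite /= ?addr0 ?add0r. Qed.

Lemma eq_linear_Xi (U : lmodType R) (f g : Xi R k -> U) :
  linear f -> linear g ->
  (forall M, f (xi0 M) = g (xi0 M)) -> (forall M, f (xi1 M) = g (xi1 M)) ->
  (forall M, f (xi2 M) = g (xi2 M)) -> f =1 g.
Proof.
move=> f_lin g_lin e0 e1 e2 z; rewrite (Xi_split z).
have addE h : linear h -> forall u w, h (u + w) = h u + h w :> U.
  by move=> h_lin u w; rewrite -[u in LHS]scale1r h_lin scale1r.
by rewrite !addE // e0 e1 e2.
Qed.

(** Turns a map prescribed on the basis v_i (x) v_j into a formula on matrices. *)
Lemma linear_mx_delta (U : lmodType R) (g : 'M[R]_k -> U) (M : 'M[R]_k) : linear g ->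
  \sum_i \sum_j M i j *: g (delta_mx i j) = g M.
Proof.
move=> g_lin.
pose G : {linear 'M[R]_k -> U} := HB.pack g (GRing.isLinear.Build R _ U _ g g_lin).
rewrite -[g]/(G : _ -> _) [in RHS](matrix_sum_delta M) linear_sum.
by apply: eq_bigr => i _; rewrite linear_sum; apply: eq_bigr => j _; rewrite linearZ.
Qed.

Variables (f0 f1 f2 : 'I_k -> 'I_k -> Xi R k).

Lemma Xi_ext_xi0 g M : linear g -> (forall i j, f0 i j = g (delta_mx i j)) ->
  Xi_ext f0 f1 f2 (xi0 M) = g M.
Proof.
move=> g_lin fg; rewrite -(linear_mx_delta M g_lin).
apply: eq_bigr => i _; apply: eq_bigr => j _.
by rewrite fg /= !mxE !scale0r !addr0.
Qed.

Lemma Xi_ext_xi1 g M : linear g -> (forall i j, f1 i j = g (delta_mx i j)) ->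
  Xi_ext f0 f1 f2 (xi1 M) = g M.
Proof.
move=> g_lin fg; rewrite -(linear_mx_delta M g_lin).
apply: eq_bigr => i _; apply: eq_bigr => j _.
by rewrite fg /= !mxE !scale0r addr0 add0r.
Qed.

Lemma Xi_ext_xi2 g M : linear g -> (forall i j, f2 i j = g (delta_mx i j)) ->
  Xi_ext f0 f1 f2 (xi2 M) = g M.
Proof.
move=> g_lin fg; rewrite -(linear_mx_delta M g_lin).
apply: eq_bigr => i _; apply: eq_bigr => j _.
by rewrite fg /= !mxE !scale0r !add0r.
Qed.

End XiComponents.

(** * Multiplication in V as a map on tensors *)

Section Multiplication.
Variables (R : comUnitRingType) (k : nat) (p : params R k).

(** The map v_i (x) v_j |-> v_{i+j}: column j holds the left factors of the terms
    in v_j. *)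
Definition Vmul (M : 'M[R]_k) : 'cV[R]_k := \sum_(j < k) YV p ^+ j *m col j M.

Fact Vmul_is_linear : linear Vmul.
Proof.
move=> a M N; rewrite /Vmul scaler_sumr -big_split; apply: eq_bigr => j _ /=.
by rewrite linearP /= mulmxDr scalemxAr.
Qed.
HB.instance Definition _ := GRing.isLinear.Build R 'M[R]_k 'cV[R]_k _ Vmul Vmul_is_linear.

Fact Wbar_is_linear : linear (Wbar p).
Proof.
by move=> a u w; rewrite /Wbar !linearP [X in X + _ = _]addrACA [LHS]addrACA -!scalerDr.
Qed.
HB.instance Definition _ := GRing.isLinear.Build R (Xi R k) (Xi R k) _ (Wbar p) Wbar_is_linear.

End Multiplication.

(** The relation for P = Y X Y passes from u to X u because X^2 u is a combination
    of u, X u and E u, and P commutes with X on the first two by what is known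
    at u and with E by hypothesis. *)
Lemma braid_on_image (R : comUnitRingType) (U : lmodType R)
    (X Y E : {linear U -> U}) (a b c : R) :
    (forall z, X (X z) = z + a *: X z - b *: E z) ->
    (forall z, E (Y (X (Y z))) = c *: E z) ->
    (forall z, Y (X (Y (E z))) = c *: E z) ->
  forall u, X (Y (X (Y u))) = Y (X (Y (X u))) ->
    X (Y (X (Y (X u)))) = Y (X (Y (X (X u)))).
Proof.
move=> XX EP PE u braid_u; rewrite -braid_u !XX.
rewrite !(linearN Y, linearD Y, linearZZ Y, linearN X, linearD X, linearZZ X).
by rewrite EP PE braid_u.
Qed.

(** The unit v_0 of the ring V.  It is locked because v_0 unfolds to a matrix
    product, in which associativity rewriting would otherwise interfere. *)
Definition Vone (R : comUnitRingType) k (p : params R k) : 'cV[R]_k := locked (vv p 0).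

(** * The maps on Xi in matrix form *)

Section XiAction.
Variables (R : comUnitRingType) (k : nat) (p : params R k).
Hypothesis k_gt0 : (0 < k)%N.
Hypothesis hp : param_conditions p.
Hypothesis hadm : admissible p.

Local Notation lm := (lam p).
Local Notation q0 := (qc p 0).
Local Notation d := (delta p).
Local Notation y := (YV p).
Local Notation x := (XV p).
Local Notation v := (vv p).
Local Notation mu := (Vmul p).
Local Notation phi M := (mu (x *m M)).
Local Notation X := (Xbar p).
Local Notation Y := (Ybar p).
Local Notation E := (Ebar p).
Local Notation W := (Wbar p).
Local Notation alpha := (Arow p).
Local Notation one := (Vone p).

Lemma delta_mx_vv (i j : 'I_k) : delta_mx i j = v i *m (v j)^T.
Proof.
rewrite !vv_basis //; apply/matrixP => r c; rewrite !mxE big_ord1 !mxE.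
by rewrite -natrM mulnb.
Qed.

Lemma YVX_add i j : y ^+ (i + j) = y ^+ i *m y ^+ j.
Proof. exact: exprD. Qed.

Lemma mu_YVX n M : mu (y ^+ n *m M) = y ^+ n *m mu M.
Proof.
rewrite /Vmul mulmx_sumr; apply: eq_bigr => j _.
by rewrite !colE !mulmxA -!YVX_add addnC.
Qed.

Lemma mu_YV M : mu (y *m M) = y *m mu M.
Proof. by have := mu_YVX 1 M; rewrite expr1. Qed.

Lemma VoneE : one = v 0.
Proof. by rewrite /Vone -lock. Qed.

Lemma EV_Vone : EV p = one *m alpha.
Proof. by rewrite VoneE EVE. Qed.

Lemma XV_Vone : x *m one = lm *: one.
Proof. by rewrite VoneE XV_v0. Qed.

Lemma WV_Vone : WV p *m one = lm^-1 *: one.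
Proof. by rewrite VoneE WV_v0. Qed.

Lemma Arow_Vone m : (m < k)%N -> alpha *m (y ^+ m *m one) = (Ac p m)%:M.
Proof. by move=> lt_mk; rewrite VoneE YVX_vv // add0r Arow_vv. Qed.

Lemma vv_exp (n : nat) : v n%:Z = y ^+ n *m one.
Proof. by rewrite VoneE YVX_vv // add0r. Qed.

Lemma mu_one (r : 'rV_k) : mu (one *m r) = r^T.
Proof.
apply/colP => i; rewrite /Vmul summxE (bigD1 i) //=.
have entry (j : 'I_k) : (y ^+ j *m col j (one *m r)) i 0 = r 0 j * (j == i)%:R.
  have -> : col j (one *m r) = r 0 j *: one.
    by rewrite colE -mulmxA -colE [col j r]mx11_scalar mul_mx_scalar mxE.
  by rewrite -scalemxAr -vv_exp vv_basis // !mxE eq_sym.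
rewrite entry eqxx mulr1 big1 ?addr0 ?mxE // => j /negPf ji.
by rewrite entry ji mulr0.
Qed.

(** Reduces statements compatible with y (x) 1 to tensors of the form 1 (x) b. *)
Lemma mx_sum_rows (M : 'M[R]_k) : M = \sum_(i < k) y ^+ i *m (one *m row i M).
Proof.
apply/matrixP => r c; rewrite summxE (bigD1 r) //= big1 => [|i /negPf ri].
  by rewrite mulmxA -vv_exp vv_basis // mxE big_ord1 !mxE eqxx mul1r addr0.
by rewrite mulmxA -vv_exp vv_basis // mxE big_ord1 !mxE (inj_eq val_inj) eq_sym ri mul0r.
Qed.

(** Multiplication by y on the right factor of a tensor, unlike on the left one, is
    not visible from the definition of [Vmul] and uses that y is cyclic. *)
Lemma mu_YVT M : mu (M *m y^T) = y *m mu M.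
Proof.
have [r ->] : exists r : 'I_k -> 'rV_k, M = \sum_(i < k) y ^+ i *m (one *m r i).
  by exists (fun i => row i M); exact: mx_sum_rows.
rewrite mulmx_suml [LHS]linear_sum [X in _ = _ *m X]linear_sum mulmx_sumr /=.
apply: eq_bigr => i _; rewrite -!mulmxA !mu_YVX !mu_one trmx_mul trmxK.
by rewrite !mulmxA YV_comm_pow.
Qed.

Lemma phi_YVT M : phi (M *m y^T) = y *m phi M.
Proof. by rewrite mulmxA mu_YVT. Qed.

(** This is Y X Y = W read through the multiplication. *)
Lemma YV_phi M : y *m phi (y *m M) = phi M - d *: mu M + d *: (alpha *m M)^T.
Proof.
rewrite -mu_YV !mulmxA YXY_V // !mulmxDl mulNmx mul_scalar_mx -scalemxAl.
by rewrite EV_Vone -mulmxA !linearD linearN !linearZ /= mu_one.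
Qed.

Local Notation eta M := (xi0 (one *m (phi M)^T)).

Lemma mu_vv (w : 'cV_k) (j : 'I_k) : mu (w *m (v j)^T) = y ^+ j *m w.
Proof.
have col_w (l : 'I_k) : col l (w *m (v j)^T) = (l == j)%:R *: w.
  rewrite colE -mulmxA -colE [col l _]mx11_scalar mul_mx_scalar.
  by rewrite vv_basis // !mxE.
rewrite /Vmul (bigD1 j) //= col_w eqxx scale1r big1 ?addr0 // => l /negPf lj.
by rewrite col_w lj scale0r mulmx0.
Qed.

Lemma Wbar1 M : W (xi1 M) = X (xi1 M) - d *: xi1 M + d *: E (xi1 M).
Proof. by []. Qed.

Lemma act0E F (i j : 'I_k) : act0 p F i j = xi0 (F *m delta_mx i j).
Proof. by rewrite delta_mx_vv mulmxA. Qed.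

Lemma ut_S (i j : 'I_k) : ut p i j.+1 = xi1 (delta_mx i j *m y^T).
Proof. by rewrite delta_mx_vv -mulmxA -trmx_mul -vv_S. Qed.

Lemma ut_1_add (i j : 'I_k) :
  ut p 1 (i + j)%N = xi1 (y *m (one *m (mu (delta_mx i j))^T)).
Proof.
by rewrite /ut /tens delta_mx_vv mu_vv mulmxA VoneE YV_vv // YVX_vv.
Qed.

Lemma Ebar0 M : E (xi0 M) = xi0 (one *m (alpha *m M)).
Proof.
apply: (@Xi_ext_xi0 _ _ _ _ _ (fun M => xi0 (one *m (alpha *m M)))) => [a N N'|i j].
  by rewrite !linearP.
by rewrite act0E EV_Vone -mulmxA.
Qed.

Fact eta_is_linear : linear (fun M => eta M : Xi R k).
Proof. by move=> a M N; rewrite !linearP. Qed.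

Lemma Ebar1 M : E (xi1 M) = eta M.
Proof.
apply: (@Xi_ext_xi1 _ _ _ _ _ (fun M => eta M)) => [|i j]; first exact: eta_is_linear.
rewrite delta_mx_vv mulmxA mu_vv /Eu /tens -VoneE; congr (xi0 (_ *m (_ *m _)^T)).
by rewrite vv_exp.
Qed.

Lemma Ebar2 M : E (xi2 M) = lm *: eta M.
Proof.
apply: (@Xi_ext_xi2 _ _ _ _ _ (fun M => lm *: eta M)) => [a N N'|i j].
  by rewrite eta_is_linear scalerDr !scalerA mulrC.
rewrite delta_mx_vv mulmxA mu_vv /Ew /tens -VoneE XV_Vone -!scalemxAr -vv_exp.
by rewrite linearZ /= -scalemxAr linearZ.
Qed.

Lemma Xbar0 M : X (xi0 M) = xi0 (x *m M).
Proof.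
apply: (@Xi_ext_xi0 _ _ _ _ _ (fun M => xi0 (x *m M))) => [a N N'|i j].
  by rewrite !linearP.
by rewrite act0E.
Qed.

Lemma Xbar1 M : X (xi1 M) = xi2 M.
Proof.
apply: (@Xi_ext_xi1 _ _ _ _ _ (fun M => xi2 M)) => [a N N'|i j].
  by rewrite linearP.
by rewrite delta_mx_vv.
Qed.

Lemma Xbar2 M : X (xi2 M) = xi1 M + d *: xi2 M - (d * lm) *: E (xi1 M).
Proof.
apply: (@Xi_ext_xi2 _ _ _ _ _ (fun M => xi1 M + d *: xi2 M - (d * lm) *: E (xi1 M))).
  by move=> a N N'; rewrite !linearP /= [X in X + _ = _]addrACA [LHS]addrACA -!scalerDr.
by move=> i j; rewrite delta_mx_vv.
Qed.

Lemma Ybar0 M : Y (xi0 M) = xi0 (y *m M).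
Proof.
apply: (@Xi_ext_xi0 _ _ _ _ _ (fun M => xi0 (y *m M))) => [a N N'|i j].
  by rewrite !linearP.
by rewrite act0E.
Qed.

Lemma Ybar1 M : Y (xi1 M) = xi1 (y *m M).
Proof.
apply: (@Xi_ext_xi1 _ _ _ _ _ (fun M => xi1 (y *m M))) => [a N N'|i j].
  by rewrite !linearP.
by rewrite delta_mx_vv mulmxA -vv_S.
Qed.

Lemma Ybar2 M : Y (xi2 M) = W (xi1 (M *m y^T))
  + d *: xi1 (y *m (one *m (mu M)^T)) - d *: xi0 (y *m x *m M).
Proof.
apply: (@Xi_ext_xi2 _ _ _ _ _ (fun M => W (xi1 (M *m y^T))
  + d *: xi1 (y *m (one *m (mu M)^T)) - d *: xi0 (y *m x *m M))).
  move=> a N N'; rewrite mulmxDl -scalemxAl !linearP.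
  by rewrite [X in X + _ = _]addrACA [LHS]addrACA -!scalerDr.
by move=> i j; rewrite ut_S ut_1_add act0E.
Qed.

(** * The relations not involving the polynomial of Y *)

(* Linearity stated at each map, so that rewriting does not unfold the maps in
   search of a sum. *)
Lemma XbarD u w : X (u + w) = X u + X w. Proof. exact: linearD. Qed.
Lemma XbarB u w : X (u - w) = X u - X w. Proof. exact: linearB. Qed.
Lemma XbarZ a u : X (a *: u) = a *: X u. Proof. exact: linearZZ. Qed.
Lemma YbarD u w : Y (u + w) = Y u + Y w. Proof. exact: linearD. Qed.
Lemma YbarB u w : Y (u - w) = Y u - Y w. Proof. exact: linearB. Qed.
Lemma YbarZ a u : Y (a *: u) = a *: Y u. Proof. exact: linearZZ. Qed.
Lemma EbarD u w : E (u + w) = E u + E w. Proof. exact: linearD. Qed.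
Lemma EbarB u w : E (u - w) = E u - E w. Proof. exact: linearB. Qed.
Lemma EbarZ a u : E (a *: u) = a *: E u. Proof. exact: linearZZ. Qed.
Let XbarL := (XbarB, XbarD, XbarZ).
Let EbarL := (EbarB, EbarD, EbarZ).

(** Ebar has image in v_0 (x) V, where Xbar and Ebar act by scalars. *)
Lemma Ebar_range z : exists r, E z = xi0 (one *m r).
Proof.
rewrite (Xi_split z) !EbarL Ebar0 Ebar1 Ebar2 -linearZZ -!linearD scalemxAr -!mulmxDr.
by eexists.
Qed.

Lemma XbarE z : X (E z) = lm *: E z.
Proof.
have [r ->] := Ebar_range z.
by rewrite Xbar0 mulmxA XV_Vone -scalemxAl linearZZ.
Qed.

Lemma Ebar_Vone r : E (xi0 (one *m r)) = Ac p 0 *: xi0 (one *m r).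
Proof.
have := Arow_Vone k_gt0; rewrite expr0 mul1mx => A0.
by rewrite Ebar0 [alpha *m _]mulmxA A0 mul_scalar_mx -scalemxAr linearZZ.
Qed.

Lemma EbarE z : E (E z) = Ac p 0 *: E z.
Proof. by have [r ->] := Ebar_range z; rewrite Ebar_Vone. Qed.

Lemma lam_unit : lm \is a GRing.unit.
Proof. by case: hp. Qed.

Lemma EbarX z : E (X z) = lm *: E z.
Proof.
have A0E := delta_Ac0 hp; have lmK := mulrV lam_unit.
apply: (@eq_linear_Xi _ _ _ (fun z => E (X z)) (fun z => lm *: E z)) z => [a u w|a u w|M|M|M].
- by rewrite !linearP.
- by rewrite linearP scalerDr !scalerA mulrC.
- rewrite Xbar0 !Ebar0 [alpha *m _]mulmxA Arow_XV // -!scalemxAl -scalemxAr.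
  by rewrite linearZZ.
- by rewrite Xbar1 Ebar1 Ebar2.
- rewrite Xbar2 !EbarL EbarE Ebar1 Ebar2 !scalerA.
  rewrite -[X in X + _ + _]scale1r -scalerDl -scalerBl; congr (_ *: _).
  rewrite mulrAC A0E; apply: (eq_of_subr_eq _ (esym lmK)); ring.
Qed.

Lemma XV_sq : x *m x = 1%:M + d *: x - (d * lm) *: (one *m alpha).
Proof.
have := XV_WV k_gt0 hp hadm; rewrite /WV mulmxDr mulmxBr -scalemxAr mul_mx_scalar.
rewrite EV_Vone mulmxA XV_Vone -scalemxAl scalerA => <-.
by rewrite addrAC addrK subrK.
Qed.

Lemma WV_XV : WV p *m x = 1%:M.
Proof. exact/mulmx1C/XV_WV. Qed.

(** On Xi_0 this is X W = 1 on V, and on u it is the definition of Xbar w. *)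
Lemma Xbar_sq z : X (X z) = z + d *: X z - (d * lm) *: E z.
Proof.
apply: (@eq_linear_Xi _ _ _ (fun z => X (X z))
   (fun z => z + d *: X z - (d * lm) *: E z)) z => [a u w|a u w|M|M|M].
- by rewrite !linearP.
- by rewrite !linearP [X in X + _ = _]addrACA [LHS]addrACA -!scalerDr.
- rewrite Ebar0 !Xbar0 mulmxA XV_sq !mulmxDl mulNmx mul1mx -!scalemxAl -mulmxA.
  by rewrite linearB linearD !(linearZZ (@xi0 R k)).
- by rewrite !Xbar1 Xbar2.
- by rewrite {1}Xbar2 !XbarL XbarE Xbar1 Ebar2 Ebar1.
Qed.

Lemma XbarW z : X (W z) = z.
Proof.
rewrite /Wbar !XbarL XbarE Xbar_sq scalerA.
by rewrite addrAC subrK addrK.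
Qed.

Lemma WbarX z : W (X z) = z.
Proof. by rewrite /Wbar EbarX Xbar_sq scalerA addrAC subrK addrK. Qed.

Lemma lamV_combination : lm - d + d * Ac p 0 = lm^-1.
Proof. by rewrite delta_Ac0 //; ring. Qed.

Lemma EbarW z : E (W z) = lm^-1 *: E z.
Proof.
rewrite /Wbar !EbarL EbarX EbarE scalerA.
by rewrite -scalerBl -scalerDl lamV_combination.
Qed.

Lemma YXY0 M : Y (X (Y (xi0 M))) = xi0 (WV p *m M).
Proof. by rewrite Ybar0 Xbar0 Ybar0 !mulmxA YXY_V. Qed.

Lemma YXY1 M : Y (X (Y (xi1 M))) = W (xi1 (y *m M *m y^T))
  + d *: xi1 (y *m (one *m (y *m mu M)^T)) - d *: xi0 (WV p *m M).
Proof. by rewrite Ybar1 Xbar1 Ybar2 mu_YV // !mulmxA YXY_V. Qed.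

Lemma XY_XY : x *m y *m x *m y = 1%:M.
Proof. by rewrite -[RHS](XV_WV k_gt0 hp hadm) -YXY_V // !mulmxA. Qed.

Lemma YX_YX : y *m x *m y *m x = 1%:M.
Proof. by rewrite YXY_V // WV_XV. Qed.

Lemma y1_mulYVT (r : 'cV_k) :
  y *m (one *m r^T) *m y^T = y *m (one *m (y *m r)^T).
Proof. by rewrite trmx_mul !mulmxA. Qed.

Lemma YVXV_y1 (r : 'cV_k) :
  y *m x *m (y *m (one *m r^T)) = lm^-1 *: (one *m r^T).
Proof. by rewrite !mulmxA YXY_V // WV_Vone -scalemxAl. Qed.

Lemma phi_y1 (r : 'cV_k) : phi (y *m (one *m (y *m r)^T)) = lm^-1 *: r.
Proof.
rewrite -y1_mulYVT phi_YVT // -mu_YV // [y *m (x *m _)]mulmxA YVXV_y1.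
by rewrite linearZ /= mu_one ?trmxK.
Qed.

(** On w(y (x) r) the corrections in Ybar cancel, because X y = lambda^-1 y^-1. *)
Lemma Ybar2_y1 (r : 'cV_k) :
  Y (xi2 (y *m (one *m r^T))) = xi2 (y *m (one *m (y *m r)^T)).
Proof.
rewrite Ybar2 y1_mulYVT Wbar1 Xbar1 Ebar1 phi_y1 YVXV_y1 mu_YV // mu_one // trmxK.
by rewrite [(lm^-1 *: r)^T]linearZ -scalemxAr /= addrAC addrK subrK.
Qed.

(** Xbar undoes the Wbar in Ybar w, and Y X Y X = 1 on V absorbs the component in
    Xi_0. *)
Lemma YXY2 M : Y (X (Y (xi2 M))) = xi1 (y *m M *m y^T)
  + d *: xi2 (y *m (one *m (y *m mu M)^T)) - d *: xi0 M.
Proof.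
have yxyx : y *m (x *m (y *m x *m M)) = M.
  by rewrite !mulmxA YX_YX mul1mx.
rewrite Ybar2 XbarB XbarD !XbarZ XbarW Xbar1 Xbar0.
by rewrite YbarB YbarD !YbarZ Ybar1 Ybar2_y1 Ybar0 yxyx mulmxA.
Qed.

(** The closed forms of P u and P w differ exactly by one application of Xbar.
    As w = Xbar u, this is the braid relation on u. *)
Lemma XbarYXY1 M : X (Y (X (Y (xi1 M)))) = Y (X (Y (xi2 M))).
Proof.
rewrite YXY1 YXY2 XbarB XbarD !XbarZ XbarW Xbar1 Xbar0.
by rewrite -YXY_V // !mulmxA XY_XY mul1mx.
Qed.

Lemma YXYE z : Y (X (Y (E z))) = lm^-1 *: E z.
Proof.
have [r ->] := Ebar_range z.
by rewrite YXY0 mulmxA WV_Vone -scalemxAl linearZZ.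
Qed.

Lemma Arow_WV : alpha *m WV p = lm^-1 *: alpha.
Proof.
rewrite -[RHS]mulmx1 -(XV_WV k_gt0 hp hadm) mulmxA -scalemxAl Arow_XV //.
by rewrite scalerA mulVr ?lam_unit // scale1r.
Qed.

(** [YV_phi] in the form needed to evaluate Ebar on P u. *)
Lemma eta_YVYVT M : one *m (phi (y *m M *m y^T))^T =
  one *m (phi M)^T - d *: (one *m (mu M)^T) + d *: (one *m (alpha *m M)).
Proof.
rewrite phi_YVT // YV_phi // [(_ + _)^T]linearD /= [(_ - _)^T]linearB /=.
by rewrite ![(_ *: _)^T]linearZ /= trmxK mulmxDr mulmxBr -!scalemxAr.
Qed.

Lemma EYXY1 M : E (Y (X (Y (xi1 M)))) = lm^-1 *: E (xi1 M).
Proof.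
rewrite YXY1 EbarB EbarD !EbarZ EbarW Ebar0 !Ebar1 eta_YVYVT phi_y1.
rewrite (mulmxA alpha (WV p)) Arow_WV [(lm^-1 *: _)^T]linearZ -scalemxAl -!scalemxAr.
rewrite linearD linearB !(linearZZ (@xi0 R k)) ![d *: (lm^-1 *: _)]scalerA.
rewrite ![d * _]mulrC -!scalerA -scalerDr -scalerBr; congr (_ *: _).
by rewrite addrAC addrK subrK.
Qed.

Lemma EbarYXY z : E (Y (X (Y z))) = lm^-1 *: E z.
Proof.
apply: (@eq_linear_Xi _ _ _ (fun z => E (Y (X (Y z))))
   (fun z => lm^-1 *: E z)) z => [a u w|a u w|M|M|M].
- by rewrite !linearP.
- by rewrite linearP scalerDr !scalerA mulrC.
- rewrite YXY0 !Ebar0 [alpha *m _]mulmxA Arow_WV -scalemxAl -scalemxAr.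
  by rewrite linearZZ.
- exact: EYXY1.
- rewrite -XbarYXY1 EbarX EYXY1 Ebar1 Ebar2 !scalerA mulVr ?mulrV ?lam_unit //.
Qed.

Lemma Xbar_braid z : X (Y (X (Y z))) = Y (X (Y (X z))).
Proof.
apply: (@eq_linear_Xi _ _ _ (fun z => X (Y (X (Y z))))
   (fun z => Y (X (Y (X z))))) z => [a u w|a u w|M|M|M].
- by rewrite !linearP.
- by rewrite !linearP.
- by rewrite YXY0 (Xbar0 M) YXY0 Xbar0 !mulmxA XV_WV // WV_XV.
- by rewrite XbarYXY1 (Xbar1 M).
- rewrite -(Xbar1 M); apply: (braid_on_image Xbar_sq EbarYXY YXYE).
  by rewrite XbarYXY1 (Xbar1 M).
Qed.

Lemma EbarYmE m z : (m < k)%N -> E (iter m Y (E z)) = Ac p m *: E z.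
Proof.
move=> lt_mk; have [r ->] := Ebar_range z.
have -> : iter m Y (xi0 (one *m r)) = xi0 (y ^+ m *m one *m r).
  elim: m {lt_mk} => [|m IHm]; first by rewrite expr0 mul1mx.
  by rewrite iterS IHm Ybar0 expmxS !mulmxA.
rewrite Ebar0 [alpha *m _]mulmxA Arow_Vone // mul_scalar_mx -scalemxAr.
by rewrite linearZZ.
Qed.

(** * The polynomial relation for Y *)

(** (y1^l - y2^l) / (y1 - y2) applied to N, where y1 = y (x) 1 and
    y2 = 1 (x) y. *)
Fixpoint divdiff l (N : 'M[R]_k) : 'M[R]_k :=
  if l is l'.+1 then y *m divdiff l' N + N *m (y^T) ^+ l' else 0.

Local Notation Dq N := (\sum_(0 <= l < k.+1) qc p l *: divdiff l N).

Lemma divdiff_linear l : linear (divdiff l).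
Proof.
elim: l => [|l IHl] a M N /=; first by rewrite scaler0 addr0.
rewrite IHl mulmxDr mulmxDl -scalemxAr -scalemxAl scalerDr.
by rewrite addrACA.
Qed.

Lemma divdiff_YV l N : divdiff l (y *m N) = y *m divdiff l N.
Proof. by elim: l => [|l IHl] /=; rewrite ?mulmx0 // IHl mulmxDr !mulmxA. Qed.

(** The identity (y1 - y2) ((y1^l - y2^l) / (y1 - y2)) = y1^l - y2^l. *)
Lemma divdiff_shift l N :
  y *m divdiff l N + N *m (y^T) ^+ l = divdiff l (N *m y^T) + y ^+ l *m N.
Proof.
elim: l => [|l IHl]; first by rewrite !expr0 mulmx1 mul1mx /= mulmx0.
by rewrite !expmxS /= IHl mulmxDr !mulmxA addrAC.
Qed.

Lemma YV_char_tr (N : 'M[R]_k) : \sum_(0 <= l < k.+1) qc p l *: (N *m (y^T) ^+ l) = 0.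
Proof.
have yT l : (y^T) ^+ l = (y ^+ l)^T.
  elim: l => [|l IHl]; first by rewrite !expr0 trmx1.
  by rewrite expmxS exprSr trmx_mul IHl.
under eq_bigr do rewrite yT scalemxAr -linearZZ.
by rewrite -mulmx_sumr -linear_sum YV_char // linear0 mulmx0.
Qed.

Fact divdiff_sum_is_linear : linear (fun N => Dq N).
Proof.
move=> a M N; rewrite scaler_sumr -big_split; apply: eq_bigr => l _.
by rewrite divdiff_linear scalerDr !scalerA mulrC.
Qed.

(** The divided difference of f is annihilated by y1 - y2, as f(y1) = f(y2) = 0. *)
Lemma divdiff_sum_shift N : Dq (y *m N) = Dq (N *m y^T).
Proof.
have char_eq : \sum_(0 <= l < k.+1) qc p l *: (N *m (y^T) ^+ l) =
    \sum_(0 <= l < k.+1) qc p l *: (y ^+ l *m N).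
  transitivity ((\sum_(0 <= l < k.+1) qc p l *: y ^+ l) *m N).
    by rewrite YV_char_tr YV_char // mul0mx.
  by rewrite mulmx_suml; apply: eq_bigr => l _; rewrite scalemxAl.
apply: (addIr (\sum_(0 <= l < k.+1) qc p l *: (N *m (y^T) ^+ l))).
rewrite [in RHS]char_eq -!big_split; apply: eq_bigr => l _ /=.
by rewrite -!scalerDr divdiff_YV divdiff_shift.
Qed.

(** Powers of y can be moved from the left factor to the right one, so N can be
    replaced by 1 (x) Vmul(N). *)
Lemma divdiff_sum_mu N : Dq N = Dq (one *m (mu N)^T).
Proof.
pose D : {linear 'M[R]_k -> 'M[R]_k} :=
  HB.pack (fun N => Dq N) (GRing.isLinear.Build R _ _ _ (fun N => Dq N) divdiff_sum_is_linear).
rewrite -[Dq N]/(D N) -[Dq (_ *m _)]/(D _).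
have [r ->] : exists r : 'I_k -> 'rV_k, N = \sum_(i < k) y ^+ i *m (one *m r i).
  by exists (fun i => row i N); exact: mx_sum_rows.
rewrite linear_sum [mu _]linear_sum [trmx _]linear_sum mulmx_sumr linear_sum /=.
apply: eq_bigr => i _; rewrite mu_YVX // mu_one //.
elim: (nat_of_ord i) (r i) => [|n IHn] s; first by rewrite !expr0 !mul1mx trmxK.
rewrite expmxS -mulmxA divdiff_sum_shift -!mulmxA IHn [(s *m _)^T]trmx_mul trmxK.
by rewrite !mulmxA YV_comm_pow.
Qed.

(** The components of Ybar w(M) - w(M y^T) in Xi_0 and, below, in Xi_1. *)
Definition Ybar2_xi0 M := d *: (one *m (y *m phi M)^T) - d *: (y *m x *m M).
Definition Ybar2_xi1 M := d *: (y *m (one *m (mu M)^T)) - d *: (M *m y^T).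

Lemma Ybar2_parts M : Y (xi2 M) = xi2 (M *m y^T) + xi1 (Ybar2_xi1 M) + xi0 (Ybar2_xi0 M).
Proof.
have regroup (a b c e f : Xi R k) : a - b + c + e - f = a + (e - b) + (c - f).
  by rewrite -!addrA; congr (_ + _); rewrite [RHS]addrCA; congr (_ + _); rewrite addrCA.
rewrite Ybar2 Wbar1 Xbar1 Ebar1 phi_YVT // regroup /Ybar2_xi0 /Ybar2_xi1.
rewrite (linearB (@xi1 R k)) !(linearZZ (@xi1 R k)).
by rewrite (linearB (@xi0 R k)) !(linearZZ (@xi0 R k)).
Qed.

Lemma Ybar2_xi1_YVT M l : Ybar2_xi1 (M *m (y^T) ^+ l) = Ybar2_xi1 M *m (y^T) ^+ l.
Proof.
elim: l M => [|l IHl] M; first by rewrite !mulmx1.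
rewrite expmxS !mulmxA IHl; congr (_ *m _).
by rewrite /Ybar2_xi1 mulmxBl -!scalemxAl mu_YVT // y1_mulYVT.
Qed.

Lemma Ybar2_xi0_YVT M l : Ybar2_xi0 (M *m (y^T) ^+ l) = Ybar2_xi0 M *m (y^T) ^+ l.
Proof.
elim: l M => [|l IHl] M; first by rewrite !mulmx1.
rewrite expmxS !mulmxA IHl; congr (_ *m _).
rewrite /Ybar2_xi0 mulmxBl -!scalemxAl phi_YVT // [(y *m (y *m _))^T]trmx_mul.
by rewrite !mulmxA.
Qed.

Lemma iter_xi2 l M : iter l Y (xi2 M) = xi2 (M *m (y^T) ^+ l)
  + xi1 (divdiff l (Ybar2_xi1 M)) + xi0 (divdiff l (Ybar2_xi0 M)).
Proof.
have regroup (a b c e f : Xi R k) : a + b + c + e + f = a + (e + b) + (f + c).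
  by rewrite -!addrA; congr (_ + _); rewrite [RHS]addrCA; congr (_ + _);
     rewrite addrC -addrA.
elim: l => [|l IHl].
  by rewrite expr0 mulmx1 (linear0 (@xi1 R k)) (linear0 (@xi0 R k)) !addr0.
rewrite iterS IHl !YbarD Ybar0 Ybar1 Ybar2_parts Ybar2_xi1_YVT Ybar2_xi0_YVT /=.
by rewrite exprSr mulmxA (linearD (@xi1 R k)) (linearD (@xi0 R k)) regroup.
Qed.

Lemma mu_Ybar2_xi1 M : mu (Ybar2_xi1 M) = 0.
Proof.
have muB u w : mu (u - w) = mu u - mu w by exact: linearB.
have muZ a u : mu (a *: u) = a *: mu u by exact: linearZZ.
by rewrite /Ybar2_xi1 muB !muZ mu_YV // mu_one // trmxK mu_YVT // subrr.
Qed.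

Lemma mu_Ybar2_xi0 M : mu (Ybar2_xi0 M) = 0.
Proof.
have muB u w : mu (u - w) = mu u - mu w by exact: linearB.
have muZ a u : mu (a *: u) = a *: mu u by exact: linearZZ.
by rewrite /Ybar2_xi0 muB !muZ mu_one // trmxK -mulmxA mu_YV // subrr.
Qed.

Lemma Ybar_char z : \sum_(l < k.+1) qc p l *: iter l Y z = 0.
Proof.
rewrite -(big_mkord xpredT (fun l => qc p l *: iter l Y z)).
apply: (@eq_linear_Xi _ _ _ (fun z => \sum_(0 <= l < k.+1) qc p l *: iter l Y z)
   (fun z => 0)) z => [a u w|a u w|M|M|M].
- rewrite scaler_sumr -big_split; apply: eq_bigr => l _ /=.
  have -> : iter l Y (a *: u + w) = a *: iter l Y u + iter l Y w.
    by elim: l => //= l ->; rewrite YbarD YbarZ.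
  by rewrite scalerDr !scalerA mulrC.
- by rewrite scaler0 addr0.
- transitivity (xi0 ((\sum_(0 <= l < k.+1) qc p l *: y ^+ l) *m M)).
    rewrite mulmx_suml linear_sum; apply: eq_bigr => l _.
    rewrite -scalemxAl linearZZ; congr (_ *: _).
    elim: l => [|l IHl]; first by rewrite mul1mx.
    by rewrite iterS IHl Ybar0 expmxS mulmxA.
  by rewrite YV_char // mul0mx linear0.
- transitivity (xi1 ((\sum_(0 <= l < k.+1) qc p l *: y ^+ l) *m M)).
    rewrite mulmx_suml linear_sum; apply: eq_bigr => l _.
    rewrite -scalemxAl linearZZ; congr (_ *: _).
    elim: l => [|l IHl]; first by rewrite mul1mx.
    by rewrite iterS IHl Ybar1 expmxS mulmxA.
  by rewrite YV_char // mul0mx linear0.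
- under eq_bigr do rewrite iter_xi2 !scalerDr -(linearZZ (@xi2 R k))
    -(linearZZ (@xi1 R k)) -(linearZZ (@xi0 R k)).
  rewrite !big_split /= -(linear_sum (@xi2 R k)) -(linear_sum (@xi1 R k)).
  rewrite -(linear_sum (@xi0 R k)).
  rewrite YV_char_tr (divdiff_sum_mu (Ybar2_xi0 M)) (divdiff_sum_mu (Ybar2_xi1 M)).
  rewrite mu_Ybar2_xi0 mu_Ybar2_xi1 trmx0 mulmx0.
  have divdiff0 l : divdiff l 0 = 0 by elim: l => //= l ->; rewrite mulmx0 mul0mx addr0.
  have Dq0 : Dq (0 : 'M[R]_k) = 0 by rewrite big1 // => l _; rewrite divdiff0 scaler0.
  by rewrite Dq0 (linear0 (@xi2 R k)) (linear0 (@xi1 R k)) (linear0 (@xi0 R k)) !addr0.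
Qed.

Definition Ybar_inv z : Xi R k := - q0^-1 *: \sum_(0 <= l < k) qc p l.+1 *: iter l Y z.

(** f(Ybar) = 0 solved for its constant term. *)
Lemma Ybar_char_tail z : - q0^-1 *: \sum_(0 <= l < k) qc p l.+1 *: iter l.+1 Y z = z.
Proof.
have q0U : q0 \is a GRing.unit by case: hp.
have := Ybar_char z; rewrite -(big_mkord xpredT (fun l => qc p l *: iter l Y z)).
rewrite big_nat_recl // addrC => /eqP; rewrite addr_eq0 => /eqP ->.
by rewrite scaleNr scalerN opprK scalerA mulVr // scale1r.
Qed.

Lemma Ybar_invK z : Y (Ybar_inv z) = z.
Proof.
rewrite -[RHS]Ybar_char_tail /Ybar_inv YbarZ; congr (_ *: _).
by rewrite linear_sum; apply: eq_bigr => l _; rewrite linearZZ.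
Qed.

Lemma Ybar_K z : Ybar_inv (Y z) = z.
Proof.
rewrite -[RHS]Ybar_char_tail /Ybar_inv; congr (_ *: _).
by apply: eq_bigr => l _; rewrite -iterSr.
Qed.

Lemma Ybar_inv_linear : linear Ybar_inv.
Proof.
move=> a u w; rewrite -[RHS]Ybar_K; congr Ybar_inv.
by rewrite YbarD YbarZ !Ybar_invK.
Qed.

End XiAction.

(** * Actions of the free algebra and of its quotient *)

Section FreeAction.
Variables (R : comUnitRingType) (U : lmodType R).
Variable rho : bgen -> U -> U.
Hypothesis rho_linear : forall g, linear (rho g).

Definition word_act (s : seq bgen) (u : U) : U := foldr rho u s.

Definition free_act (a : free_alg R) (u : U) : U :=
  \sum_(m <- msupp a) mcoeff m a *: word_act m u.

Lemma word_act_linear s : linear (word_act s).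
Proof.
elim: s => // g s IHs c u w.
by rewrite [LHS](congr1 (rho g) (IHs c u w)) rho_linear.
Qed.

Lemma free_act_linear a : linear (free_act a).
Proof.
move=> c u w; rewrite /free_act scaler_sumr -big_split; apply: eq_bigr => m _ /=.
by rewrite word_act_linear scalerDr !scalerA mulrC.
Qed.

Lemma free_actEw (D : {fset {fmonom bgen}}) a u : (msupp a `<=` D)%fset ->
  free_act a u = \sum_(m <- D) mcoeff m a *: word_act m u.
Proof.
move=> sub; rewrite /free_act; apply: big_fset_incl => // m _ /mcoeff_outdom ->.
by rewrite scale0r.
Qed.

Lemma free_actU c m u : free_act << c *g m >> u = c *: word_act m u.
Proof. by rewrite (free_actEw _ msuppU_le) big_seq_fset1 mcoeffUU. Qed.

Lemma free_actP c (a b : free_alg R) u :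
  free_act (c *: a + b) u = c *: free_act a u + free_act b u.
Proof.
pose D := (msupp (c *: a + b) `|` (msupp a `|` msupp b))%fset.
have subab : (msupp (c *: a + b) `<=` D)%fset by exact: fsubsetUl.
have suba : (msupp a `<=` D)%fset.
  by apply: fsubset_trans (fsubsetUr _ _); exact: fsubsetUl.
have subb : (msupp b `<=` D)%fset.
  by apply: fsubset_trans (fsubsetUr _ _); exact: fsubsetUr.
rewrite !(@free_actEw D) // scaler_sumr -big_split; apply: eq_bigr => m _ /=.
by rewrite mcoeffD mcoeffZ scalerDl scalerA.
Qed.

Lemma free_actD (a b : free_alg R) u : free_act (a + b) u = free_act a u + free_act b u.
Proof. by have := free_actP 1 a b u; rewrite !scale1r. Qed.

Lemma free_act0 u : free_act 0 u = 0.
Proof. by rewrite /free_act msupp0 big_seq_fset0. Qed.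

Lemma free_actZ c (a : free_alg R) u : free_act (c *: a) u = c *: free_act a u.
Proof. by have := free_actP c a 0 u; rewrite free_act0 !addr0. Qed.

Lemma free_actN (a : free_alg R) u : free_act (- a) u = - free_act a u.
Proof. by apply/eqP; rewrite -addr_eq0 -free_actD addNr free_act0. Qed.

Lemma free_act_sum (I : Type) (r : seq I) (F : I -> free_alg R) u :
  free_act (\sum_(i <- r) F i) u = \sum_(i <- r) free_act (F i) u.
Proof. by apply: (big_morph (free_act^~ u)) => [a b|]; rewrite ?free_actD ?free_act0. Qed.

Lemma word_act_mul (m n : {fmonom bgen}) u :
  word_act (mmul m n) u = word_act m (word_act n u).
Proof. by rewrite [mmul _ _]fmmulE /word_act /= foldr_cat. Qed.

Lemma free_actM (a b : free_alg R) u : free_act (a * b) u = free_act a (free_act b u).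
Proof.
rewrite malgME free_act_sum; apply: eq_bigr => m _.
have wordD v w : word_act m (v + w) = word_act m v + word_act m w.
  by have := word_act_linear m 1 v w; rewrite !scale1r.
have word0 : word_act m 0 = 0.
  by apply: (addrI (word_act m 0)); rewrite -wordD !addr0.
have wordZ c w : word_act m (c *: w) = c *: word_act m w.
  by have := word_act_linear m c w 0; rewrite word0 !addr0.
rewrite free_act_sum {2}/free_act.
rewrite (big_morph (word_act m) wordD word0) scaler_sumr; apply: eq_bigr => n _.
by rewrite free_actU word_act_mul wordZ scalerA.
Qed.

Lemma free_actM3 (a b c : free_alg R) u :
  free_act (a * b * c) u = free_act a (free_act b (free_act c u)).
Proof. by rewrite !free_actM. Qed.

Lemma free_actM4 (a b c d : free_alg R) u :
  free_act (a * b * c * d) u =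
  free_act a (free_act b (free_act c (free_act d u))).
Proof. by rewrite !free_actM. Qed.

Lemma free_act1 u : free_act 1 u = u.
Proof. by rewrite free_actU scale1r /word_act [mone]fmoneE. Qed.

Lemma free_act_var g u : free_act (fvar R g) u = rho g u.
Proof. by rewrite free_actU scale1r /word_act fmuE. Qed.

End FreeAction.

Section QuotientAction.
Variables (R : comUnitRingType) (k : nat) (p : params R k).
Variable rho : bgen -> Xi R k -> Xi R k.
Hypothesis rho_linear : forall g, linear (rho g).
Hypothesis rho_rel : forall a b, brel p a b ->
  forall u, free_act rho a u = free_act rho b u.

Lemma free_act_ideal a : two_sided_ideal (brel_diff p) a ->
  forall u, free_act rho a u = 0.
Proof.
elim=> {a} [a [b [c [rel_bc ->]]]| |a b _ IHa _ IHb|a b c _ IHb] u.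
- by rewrite free_actD free_actN (rho_rel rel_bc) subrr.
- exact: free_act0.
- by rewrite free_actD IHa IHb addr0.
- rewrite !free_actM // IHb.
  by have := free_act_linear rho_linear a 1 0 0; rewrite !scale1r addr0
    => /eqP; rewrite -subr_eq subrr eq_sym => /eqP.
Qed.

Definition quotient_act (a : B2 p) (u : Xi R k) : Xi R k := free_act rho (repr a) u.

Lemma quotient_act_pi (a : free_alg R) u :
  quotient_act (tsq_pi (brel_diff p) a) u = free_act rho a u.
Proof.
apply: subr0_eq; rewrite /quotient_act -free_actN -free_actD.
exact/free_act_ideal/tsq_repr_pi.
Qed.

Lemma quotient_act_action : is_B2_action quotient_act.
Proof.
split.
- elim/tsq_ind => a; elim/tsq_ind => b u.
  by rewrite -rmorphM !quotient_act_pi free_actM.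
- by move=> u; rewrite -(rmorph1 (tsq_pi _)) quotient_act_pi free_act1.
- by move=> a u w; have := free_act_linear rho_linear (repr a) 1 u w; rewrite !scale1r.
- elim/tsq_ind => a; elim/tsq_ind => b u.
  by rewrite -rmorphD !quotient_act_pi free_actD.
- move=> c; elim/tsq_ind => a u.
  by rewrite -tsq_piZ !quotient_act_pi free_actZ.
Qed.

Lemma quotient_act_var g u : quotient_act (bvar p g) u = rho g u.
Proof. by rewrite quotient_act_pi free_act_var. Qed.

End QuotientAction.

Theorem theorem4p2 (R : comUnitRingType) (k : nat) (hk : (0 < k)%N)
    (p : params R k) (hp : param_conditions p) (hadm : admissible p) :
  [/\ forall x : Xi R k, Xbar p (Wbar p x) = x,
      forall x : Xi R k, Wbar p (Xbar p x) = x,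
      forall x : Xi R k, Xbar p (Ebar p x) = lam p *: Ebar p x &
      forall x : Xi R k, Ebar p (Xbar p x) = lam p *: Ebar p x] /\
  [/\ forall x : Xi R k,
        Xbar p (Ybar p (Xbar p (Ybar p x))) = Ybar p (Xbar p (Ybar p (Xbar p x))),
      forall x : Xi R k,
        Ebar p (Ybar p (Xbar p (Ybar p x))) = (lam p)^-1 *: Ebar p x &
      forall x : Xi R k,
        Ybar p (Xbar p (Ybar p (Ebar p x))) = (lam p)^-1 *: Ebar p x] /\
  (forall m : nat, (m <= k.-1)%N -> forall x : Xi R k,
     Ebar p (iter m (Ybar p) (Ebar p x)) = Ac p m *: Ebar p x) /\
  (forall x : Xi R k, \sum_(l < k.+1) qc p l *: iter l (Ybar p) x = 0) /\
  exists act : B2 p -> Xi R k -> Xi R k,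
    is_B2_action act /\
    [/\ forall x : Xi R k, act (bvar p gY) x = Ybar p x,
        forall x : Xi R k, act (bvar p gX) x = Xbar p x,
        forall x : Xi R k, act (bvar p gXinv) x = Wbar p x &
        forall x : Xi R k, act (bvar p gE) x = Ebar p x].
Proof.
split; first by split=> z; [exact: XbarW|exact: WbarX|exact: XbarE|exact: EbarX].
split; first by split=> z; [exact: Xbar_braid|exact: EbarYXY|exact: YXYE].
split; first by move=> m le_mk z; apply: EbarYmE => //; rewrite -(prednK hk).
split; first exact: Ybar_char.
pose rho g : Xi R k -> Xi R k := match g with
  gY => Ybar p | gYinv => Ybar_inv p | gX => Xbar p | gXinv => Wbar p | gE => Ebar p end.
have rho_linear g : linear (rho g).
  by case: g; [exact: linearP|exact: Ybar_inv_linear|exact: linearP..].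
have free_actX (a : free_alg R) n u : free_act rho (a ^+ n) u = iter n (free_act rho a) u.
  elim: n => [|n IHn]; first by rewrite expr0 free_act1.
  by rewrite exprS free_actM // IHn.
have iterY n w : iter n (free_act rho (fvar R gY)) w = iter n (Ybar p) w.
  by apply: eq_iter => z; rewrite free_act_var.
have rho_rel a b : brel p a b -> forall u, free_act rho a u = free_act rho b u.
  case=> [||||||||||| m lt_mk] u.
  - rewrite free_actM // free_act1 !free_act_var; exact: Ybar_invK.
  - rewrite free_actM // free_act1 !free_act_var; exact: Ybar_K.
  - rewrite free_actM // free_act1 !free_act_var; exact: XbarW.
  - rewrite free_actM // free_act1 !free_act_var; exact: WbarX.
  - rewrite free_actX iterY free_act_sum.
    have := Ybar_char hk hp u; rewrite big_ord_recr /= qc_k scaleN1r.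
    move/eqP; rewrite subr_eq0 => /eqP <-; apply: eq_bigr => l _.
    by rewrite free_actZ free_actX iterY.
  - rewrite free_actD free_actN free_actZ free_actD free_actN free_act1 !free_act_var.
    by rewrite /rho /Wbar scalerBr opprD opprB addrA [X in X - _]addrC subrK.
  - rewrite [LHS](free_actM4 rho_linear) [RHS](free_actM4 rho_linear).
    rewrite !free_act_var; exact: Xbar_braid.
  - rewrite free_actZ (free_actM rho_linear) !free_act_var; exact: XbarE.
  - rewrite free_actZ (free_actM rho_linear) !free_act_var; exact: EbarX.
  - rewrite free_actZ (free_actM4 rho_linear) !free_act_var; exact: YXYE.
  - rewrite free_actZ (free_actM4 rho_linear) !free_act_var; exact: EbarYXY.
  - rewrite free_actZ (free_actM3 rho_linear) free_actX iterY !free_act_var.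
    exact: EbarYmE.
exists (quotient_act (p := p) rho); split; first exact: quotient_act_action.
by split=> z; apply: (quotient_act_var rho_linear rho_rel).
Qed.
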